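(* Let $p$ and $d$ be positive integers, let $\mathbf{\Sigma} \in \mathcal{S}_p^+$ and let $\boldsymbol{\mu} \in \mathbb{R}^p$. Let $\mathbf{W}$ be a $p \times d$ random matrix whose columns are independent and identically distributed, each following the $\mathcal{N}(0,\mathbf{\Sigma})$ distribution on $\mathbb{R}^p$, and let $\mathbf{y} \sim \mathcal{N}(0,\mathbf{I}_d)$ be a Gaussian vector in $\mathbb{R}^d$ independent of $\mathbf{W}$. Then $$\mathbf{W}\mathbf{y} + \|\mathbf{y}\|_2^2\,\boldsymbol{\mu} \sim \mathrm{GAL}_p(2\mathbf{\Sigma}, 2\boldsymbol{\mu}, d/2).$$
   Context: $\mathcal{S}_p^+$ denotes the cone of (symmetric) positive semidefinite real matrices of size $p \times p$; $\mathcal{N}(0,\mathbf{\Sigma})$ is the centered Gaussian distribution with covariance matrix $\mathbf{\Sigma}$ (possibly degenerate); $\mathbf{I}_d$ is the $d \times d$ identity matrix; $\|\cdot\|_2$ is the Euclidean norm. For $s>0$, $\boldsymbol{\mu} \in \mathbb{R}^p$ and $\mathbf{\Sigma} \in \mathcal{S}_p^+$, a random variable $\mathbf{z} \in \mathbb{R}^p$ is said to have a multivariate generalized asymmetric Laplace distribution with parameters $s, \boldsymbol{\mu}, \mathbf{\Sigma}$, denoted $\mathbf{z} \sim \mathrm{GAL}_p(\mathbf{\Sigma},\boldsymbol{\mu},s)$, if its characteristic function is $$\forall \mathbf{u} \in \mathbb{R}^p, \quad \mathbb{E}\left[e^{i\mathbf{u}^T\mathbf{z}}\right] = \left(\frac{1}{1+\frac{1}{2}\mathbf{u}^T\mathbf{\Sigma}\mathbf{u}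 - i\boldsymbol{\mu}^T\mathbf{u}}\right)^s,$$ where the complex power is taken with the principal branch (the base has positive real part). *)

(* Defs.v *)
From HB Require Import structures.
From mathcomp Require Import all_boot all_order all_algebra.
From mathcomp Require Import complex.
From mathcomp Require Import all_classical all_reals all_analysis.

Set Implicit Arguments.
Unset Strict Implicit.
Unset Printing Implicit Defensive.

Import Order.TTheory GRing.Theory Num.Theory.
Import numFieldNormedType.Exports.

Local Open Scope classical_set_scope.
Local Open Scope ring_scope.
Local Open Scope complex_scope.

Definition measure_matrix_display : measure_display -> measure_display.
Proof. exact. Qed.

(* The product sigma-algebra on matrices, generated by the entries; over R it
   is the Borel sigma-algebra. *)
Section measurable_matrix.
Context {d : measure_display} {T : measurableType d} (m n : nat).

Definition matrix_cylinders : set (set 'M[T]_(m, n)) :=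
  [set C | exists (i : 'I_m) (j : 'I_n) (A : set T),
     measurable A /\ C = (fun M : 'M[T]_(m, n) => M i j) @^-1` A].

Let matrix_set0 : <<s matrix_cylinders >> set0.
Proof. exact: sigma_algebra0. Qed.

Let matrix_setC A :
  <<s matrix_cylinders >> A -> <<s matrix_cylinders >> (~` A).
Proof. exact: sigma_algebraC. Qed.

Let matrix_bigcup (F : (set 'M[T]_(m, n))^nat) :
  (forall i, <<s matrix_cylinders >> (F i)) ->
  <<s matrix_cylinders >> (\bigcup_i F i).
Proof. exact: sigma_algebra_bigcup. Qed.

HB.instance Definition _ := @isMeasurable.Build (measure_matrix_display d)
  'M[T]_(m, n) <<s matrix_cylinders >> matrix_set0 matrix_setC matrix_bigcup.

End measurable_matrix.

Section linear_algebra.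
Context {R : realType}.

Definition psd (n : nat) (S : 'M[R]_n) : Prop :=
  S^T = S /\ forall u : 'cV[R]_n, 0 <= (u^T *m S *m u) 0 0.

(* The library norm on matrices is the sup norm. *)
Definition norm2 (n : nat) (x : 'cV[R]_n) : R :=
  Num.sqrt (\sum_(i < n) x i 0 ^+ 2).

End linear_algebra.

Section complex_functions.
Context {R : realType}.

Definition expC (z : R[i]) : R[i] :=
  (expR (complex.Re z) * cos (complex.Im z))
    +i* (expR (complex.Re z) * sin (complex.Im z)).

Definition absC (z : R[i]) : R :=
  Num.sqrt (complex.Re z ^+ 2 + complex.Im z ^+ 2).

(* Principal argument, in ]-pi, pi] for z != 0. *)
Definition argC (z : R[i]) : R :=
  if 0 <= complex.Im z then acos (complex.Re z / absC z)
  else - acos (complex.Re z / absC z).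

(* Principal logarithm, for z != 0. *)
Definition logC (z : R[i]) : R[i] := ln (absC z) +i* argC z.

Definition powC (z : R[i]) (s : R) : R[i] := expC (s%:C * logC z).

End complex_functions.

Section probability_notions.
Context {d : measure_display} {T : measurableType d} {R : realType}.
Variable P : probability T R.

Definition independent2 (d1 d2 : measure_display) (T1 : measurableType d1)
    (T2 : measurableType d2) (X : T -> T1) (Y : T -> T2) : Prop :=
  forall (A : set T1) (B : set T2), measurable A -> measurable B ->
    P (X @^-1` A `&` Y @^-1` B) = (P (X @^-1` A) * P (Y @^-1` B))%E.

Definition mutually_independent (I : finType) (d1 : measure_display)
    (T1 : measurableType d1) (X : I -> T -> T1) : Prop :=
  forall (J : {set I}) (A : I -> set T1), (forall j, measurable (A j)) ->
    P (\bigcap_(j in [set` J]) (X j @^-1` A j)) =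
    (\prod_(j in J) P (X j @^-1` A j))%E.

Definition expectationC (Z : T -> R[i]) : R[i] :=
  fine ('E_P[fun t => complex.Re (Z t)])%E
    +i* fine ('E_P[fun t => complex.Im (Z t)])%E.

Definition char_fun (n : nat) (Z : T -> 'cV[R]_n) (u : 'cV[R]_n) : R[i] :=
  expectationC (fun t => expC ('i%C * ((u^T *m Z t) 0 0)%:C)).

(* Real centered Gaussian law of variance v >= 0. The case v = 0 is the Dirac
   mass at 0 and has to be singled out: [normal_prob m 0] is the uniform law
   on [0, 1]. *)
Definition gaussian_law (v : R) (A : set R) : \bar R :=
  if v == 0 then \d_(0 : R) A else normal_prob 0 (Num.sqrt v) A.

(* X ~ N(0, S), possibly degenerate: every linear combination u^T X of the
   coordinates of X has law N(0, u^T S u). *)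
Definition centered_gaussian (n : nat) (S : 'M[R]_n) (X : T -> 'cV[R]_n) :
    Prop :=
  measurable_fun setT X /\
  forall (u : 'cV[R]_n) (A : set R), measurable A ->
    P ((fun t => (u^T *m X t) 0 0) @^-1` A) =
    gaussian_law ((u^T *m S *m u) 0 0) A.

Definition GAL (n : nat) (S : 'M[R]_n) (mu : 'cV[R]_n) (s : R)
    (Z : T -> 'cV[R]_n) : Prop :=
  [/\ 0 < s, psd S, measurable_fun setT Z &
    forall u : 'cV[R]_n,
      char_fun Z u =
      powC (1 / (1 + (2^-1 * (u^T *m S *m u) 0 0)%:C
                 - 'i%C * ((mu^T *m u) 0 0)%:C)) s].

End probability_notions.

(* Main.v *)
(* Put s = u^T Sigma u / 2 and a = u^T mu. Conditionally on y, the independent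
   Gaussian columns of W give E exp(i u^T (W y + |y|^2 mu)) =
   prod_j exp(-(s - ia) y_j^2), so the claim reduces to computing
   E prod_j exp(-(s - ia) y_j^2) for y ~ N(0, I_d), where only the laws of the
   linear forms v^T y are given. Writing exp(-t x^2) as the mean of
   exp(i sqrt(2t) xi x) over xi ~ N(0, 1) turns the known values
   E exp(i v^T y) = prod_j exp(-v_j^2 / 2) into the corresponding formula with
   exp(-t y_j^2) in place of exp(i v_j y_j), one coordinate at a time and for
   real t >= 0; uniqueness of Laplace transforms then extends it to complex t.
   Hence the expectation is phi^d with phi = E exp(-(s - ia) xi^2). Finally
   phi^2 = 1 / (1 + 2s - 2ia), because the sum of two independent squared
   standard Gaussians is exponential, and Re phi > 0 by continuity in a, so
   phi^d is the principal power of exponent d / 2. *)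

Require Import Defs.
From mathcomp Require Import all_boot all_order all_algebra.
From mathcomp Require Import finmap complex.
From mathcomp Require Import all_classical all_reals all_analysis.
From mathcomp Require Import measurable_realfun.
From mathcomp Require Import ring lra.

Set Implicit Arguments.
Unset Strict Implicit.
Unset Printing Implicit Defensive.

Import Order.TTheory GRing.Theory Num.Theory.
Import numFieldNormedType.Exports.

Local Open Scope classical_set_scope.
Local Open Scope ring_scope.


(** * Bounded measurable functions *)

Section bounded_measurable.
Import HBSimple HBNNSimple.
Context {disp : measure_display} {T : measurableType disp} {R : realType}.
Implicit Types (f g : T -> R) (P : probability T R).

(** The hypothesis on [y] gives the laws of its linear forms only: neither a joint density nor
    independence of the coordinates is at hand, so the mean of the product cannot be split directly.
    What is known is the product formula for factors exp(i v_j y_j), and it has to be carried over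
    to other factors one coordinate at a time while the remaining ones stay in place. These are kept
    as a complex weight [h], which is why transfer and Laplace uniqueness below are about means of h
    f(X) with a bounded complex [h], and not only about laws. All test functions are bounded and
    measurable: under a probability this alone gives integrability, Fubini and passage to pointwise
    limits under a common bound. The value of phi^2 leaves a sign open, and for odd d this sign
    matters; Re phi > 0 is what identifies phi with the principal square root. *)

Definition bmeas f := measurable_fun setT f /\ exists M : R, forall x, `|f x| <= M.

Lemma bmeas_cst (k : R) : bmeas (cst k).
Proof. by split => //; exists `|k| => x. Qed.

Lemma bmeas_indic A : measurable A -> bmeas (\1_A : T -> R).
Proof.
move=> mA; split => //; exists 1 => x.
by rewrite indicE; case: (_ \in _); rewrite ?normr1 ?normr0.
Qed.

Lemma bmeasD f g : bmeas f -> bmeas g -> bmeas (fun x => f x + g x).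
Proof.
move=> [mf [M fM]] [mg [N gN]]; split; first exact: measurable_funD.
by exists (M + N) => x; rewrite (le_trans (ler_normD _ _))// lerD.
Qed.

Lemma bmeasM f g : bmeas f -> bmeas g -> bmeas (fun x => f x * g x).
Proof.
move=> [mf [M fM]] [mg [N gN]]; split; first exact: measurable_funM.
by exists (M * N) => x; rewrite normrM ler_pM.
Qed.

Lemma bmeasN f : bmeas f -> bmeas (fun x => - f x).
Proof.
move=> [mf [M fM]]; split; first exact: measurable_funN.
by exists M => x; rewrite normrN.
Qed.

Lemma bmeas_norm f : bmeas f -> bmeas (fun x => `|f x|).
Proof.
move=> [mf [M fM]]; split; first exact: measurableT_comp.
by exists M => x; rewrite normr_id.
Qed.

Lemma bmeasB f g : bmeas f -> bmeas g -> bmeas (fun x => f x - g x).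
Proof. by move=> bf bg; apply: bmeasD => //; exact: bmeasN. Qed.

Lemma bmeas_integrable P f : bmeas f -> P.-integrable setT (EFin \o f).
Proof.
move=> [mf [M fM]]; apply: measurable_bounded_integrable => //.
  exact: (le_lt_trans (probability_le1 P measurableT) (ltry 1)).
exists M; split; [exact: num_real|move=> x Mx y _].
 exact: (le_trans (fM y) (ltW Mx)).
Qed.

Lemma bmeas_cvg (f_ : nat -> T -> R) f (M : R) :
    (forall n, bmeas (f_ n)) -> (forall n x, `|f_ n x| <= M) ->
  (forall x, f_ ^~ x @ \oo --> f x) -> bmeas f.
Proof.
move=> bf fM ff; split.
  apply: (@measurable_fun_cvg _ _ _ setT f_) => [m|x _]; [exact: (bf m).1|exact: ff].
exists M => x.
have /cvg_norm : f_ ^~ x @ \oo --> f x by [].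
move=> h; rewrite -(cvg_lim _ h)//; apply: limr_le.
  by apply/cvg_ex; eexists; exact: h.
by apply: nearW => n; exact: fM.
Qed.

(** A functional monotone class principle. If |f| <= M, then f + M is nonnegative, hence the
    increasing limit of simple functions, all bounded by 2M; simple functions are finite
    combinations of indicators, and subtracting the constant M is one more linear step. *)
Lemma bmeas_ind (S : (T -> R) -> Prop) :
    (forall A, measurable A -> S \1_A) ->
    (forall f g (a : R), bmeas f -> bmeas g -> S f -> S g ->
       S (fun x => a * f x + g x)) ->
    (forall (f_ : nat -> T -> R) f (M : R), (forall n, bmeas (f_ n)) ->
       (forall n x, `|f_ n x| <= M) -> (forall x, f_ ^~ x @ \oo --> f x) ->
       (forall n, S (f_ n)) -> S f) ->
  forall f, bmeas f -> S f.
Proof.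
move=> S1 SD Slim f [mf [M fM]].
have S0 : S (cst 0) by have := S1 set0 measurable0; rewrite indic0.
pose g x := f x + M.
have g0 x : 0 <= g x by have := fM x; rewrite /g ler_norml => /andP[]; lra.
have mg : measurable_fun setT (EFin \o g).
  by apply/measurable_EFinP; exact: measurable_funD.
have Sfin (I : seq R) (c : R -> R) (B : R -> set T) : (forall y, measurable (B y)) ->
    bmeas (fun x => \sum_(y <- I) c y * \1_(B y) x) /\
    S (fun x => \sum_(y <- I) c y * \1_(B y) x).
  move=> mB; elim: I => [|y I [bI SI]].
    rewrite (_ : (fun _ => _) = cst 0); first by split => //; exact: bmeas_cst.
    by apply/funext => x; rewrite big_nil.
  rewrite (_ : (fun _ => _) =
      fun x => c y * \1_(B y) x + \sum_(y <- I) c y * \1_(B y) x); last first.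
    by apply/funext => x; rewrite big_cons.
  split.
    by apply: bmeasD => //; apply: bmeasM; [exact: bmeas_cst|exact: bmeas_indic].
  by apply: SD => //; [exact: bmeas_indic|exact: S1].
pose h := nnsfun_approx measurableT mg.
have hE n : (h n : T -> R) =
    fun x => \sum_(y <- fset_set (range (h n))) y * \1_(h n @^-1` [set y]) x.
  by apply/funext => x; rewrite (fimfunE (h n)) fsbig_finite.
have hS n : bmeas (h n) /\ S (h n).
  by rewrite hE; apply: Sfin => y; exact: measurable_sfunP.
have Sg : S g.
  apply: (Slim (fun n => h n : T -> R) g (M + M)).
  - by move=> n; exact: (hS n).1.
  - move=> n x; rewrite ger0_norm; last exact: fun_ge0.
    rewrite -lee_fin (@le_trans _ _ (g x)%:E)//.
      by rewrite /h nnsfun_approxE; apply: le_approx => //= y _; rewrite lee_fin.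
    by rewrite lee_fin /g lerD2r (le_trans (ler_norm _)).
  - move=> x; apply: (@fine_cvg _ _ _ _ (fun n => (h n x)%:E) (g x)).
    by apply: cvg_nnsfun_approx => // y _; rewrite lee_fin.
  - by move=> n; exact: (hS n).2.
have bg : bmeas g by apply: bmeasD; [split => //; exists M|exact: bmeas_cst].
rewrite (_ : f = fun x => (- M) * \1_setT x + g x); last first.
  by apply/funext => x; rewrite /g indicT/= mulr1; lra.
by apply: SD => //; [exact: bmeas_indic|exact: S1].
Qed.

Lemma bounded_cvg_Rintegral P (f_ : nat -> T -> R) f (M : R) :
    (forall n, bmeas (f_ n)) -> (forall n x, `|f_ n x| <= M) ->
    (forall x, f_ ^~ x @ \oo --> f x) ->
  \int[P]_x f_ n x @[n --> \oo] --> \int[P]_x f x.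
Proof.
move=> bf fM ff; have bl := bmeas_cvg bf fM ff.
apply: fine_cvg; rewrite fineK; last first.
  by apply: integrable_fin_num => //; exact: bmeas_integrable.
apply: (@dominated_cvg _ _ _ P setT measurableT (fun n x => (f_ n x)%:E) _ (cst M%:E)).
- by move=> n; apply/measurable_EFinP; exact: (bf n).1.
- by move=> x _; apply: cvg_EFin; [exact: nearW|exact: ff].
- by [].
- exact: (bmeas_integrable P (bmeas_cst M)).
- by move=> n x _; rewrite lee_fin.
Qed.

End bounded_measurable.

(** * Complex-valued expectations *)

Local Open Scope complex_scope.

Section complex_exponential.
Context {R : realType}.
Implicit Types (a b z : R[i]) (x : R).

Lemma eqC a b : complex.Re a = complex.Re b -> complex.Im a = complex.Im b -> a = b.
Proof. by case: a b => [a1 a2] [b1 b2] /= -> ->. Qed.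

Lemma ReM a b : complex.Re (a * b) =
  complex.Re a * complex.Re b - complex.Im a * complex.Im b.
Proof. by case: a b => [a1 a2] [b1 b2]. Qed.

Lemma ImM a b : complex.Im (a * b) =
  complex.Re a * complex.Im b + complex.Im a * complex.Re b.
Proof. by case: a b => [a1 a2] [b1 b2]. Qed.

Lemma ReD a b : complex.Re (a + b) = complex.Re a + complex.Re b.
Proof. by case: a b => [a1 a2] [b1 b2]. Qed.

Lemma ImD a b : complex.Im (a + b) = complex.Im a + complex.Im b.
Proof. by case: a b => [a1 a2] [b1 b2]. Qed.

Lemma ReN a : complex.Re (- a) = - complex.Re a.
Proof. by case: a. Qed.

Lemma ImN a : complex.Im (- a) = - complex.Im a.
Proof. by case: a. Qed.

Lemma expCD a b : expC (a + b) = expC a * expC b.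
Proof.
by apply: eqC; rewrite ?ReM ?ImM/= ReD ImD expRD ?cosD ?sinD; ring.
Qed.

Lemma expC0 : expC (0 : R[i]) = 1.
Proof. by apply: eqC; rewrite /= expR0 ?cos0 ?sin0 mul1r. Qed.

Lemma expCX z n : expC (n%:R * z) = expC z ^+ n.
Proof.
elim: n => [|n IH]; first by rewrite mul0r expC0.
by rewrite -natr1 mulrDl mul1r expCD IH exprSr.
Qed.

(** Written through [expC] so that the integrand of [char_fun] is an instance of it by
    conversion. *)
Definition cis x : R[i] := expC ('i%C * x%:C).

Lemma cisE x : cis x = cos x +i* sin x.
Proof. by apply: eqC; rewrite /= !mul0r ?mul1r ?subr0 ?add0r ?addr0 expR0 mul1r. Qed.

Lemma cisD x y : cis (x + y) = cis x * cis y.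
Proof. by rewrite -expCD; congr expC; apply: eqC => /=; ring. Qed.

Lemma cis0 : cis (0 : R) = 1.
Proof. by rewrite cisE cos0 sin0. Qed.

Lemma cis_sum (I : Type) (s : seq I) (f : I -> R) :
  cis (\sum_(i <- s) f i) = \prod_(i <- s) cis (f i).
Proof. exact: (big_morph cis cisD cis0). Qed.

End complex_exponential.

Section bounded_measurable_complex.
Context {disp : measure_display} {T : measurableType disp} {R : realType}.
Implicit Types (f g h : T -> R[i]) (P : probability T R).

Definition bmeasC f :=
  bmeas (fun x => complex.Re (f x)) /\ bmeas (fun x => complex.Im (f x)).

Lemma bmeasC_cst (k : R[i]) : bmeasC (fun=> k).
Proof. by split; exact: bmeas_cst. Qed.

Lemma bmeasC_real (f : T -> R) : bmeas f -> bmeasC (fun x => (f x)%:C).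
Proof. by split => //; exact: bmeas_cst. Qed.

Lemma bmeasCD f g : bmeasC f -> bmeasC g -> bmeasC (fun x => f x + g x).
Proof.
move=> [f1 f2] [g1 g2]; split.
  by under eq_fun do rewrite ReD; exact: bmeasD.
by under eq_fun do rewrite ImD; exact: bmeasD.
Qed.

Lemma bmeasCM f g : bmeasC f -> bmeasC g -> bmeasC (fun x => f x * g x).
Proof.
move=> [f1 f2] [g1 g2]; split.
  by under eq_fun do rewrite ReM; apply: bmeasB; exact: bmeasM.
by under eq_fun do rewrite ImM; apply: bmeasD; exact: bmeasM.
Qed.

Lemma bmeasC_prod (I : Type) (s : seq I) (p : pred I) (f : I -> T -> R[i]) :
  (forall i, bmeasC (f i)) -> bmeasC (fun x => \prod_(i <- s | p i) f i x).
Proof.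
move=> bf; elim: s => [|i s IH].
  by under eq_fun do rewrite big_nil; exact: bmeasC_cst.
under eq_fun do rewrite big_cons; case: (p i) => //.
exact: bmeasCM.
Qed.

Lemma bmeasC_cis (f : T -> R) : measurable_fun setT f -> bmeasC (fun x => cis (f x)).
Proof.
move=> mf; split; under eq_fun do rewrite cisE/=; split.
- apply: measurableT_comp => //; apply: continuous_measurable_fun; exact: continuous_cos.
- by exists 1 => x; exact: cos_max.
- apply: measurableT_comp => //; apply: continuous_measurable_fun; exact: continuous_sin.
- by exists 1 => x; exact: sin_max.
Qed.

Lemma bmeas_expRN (f : T -> R) : measurable_fun setT f ->
  (forall x, 0 <= f x) -> bmeas (fun x => expR (- f x)).
Proof.
move=> mf f0; split; first by apply: measurableT_comp => //; exact: measurable_funN.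
by exists 1 => x; rewrite ger0_norm ?expR_ge0// -expR0 ler_expR oppr_le0.
Qed.

Lemma expectationCE P f : expectationC P f =
  (\int[P]_x complex.Re (f x)) +i* (\int[P]_x complex.Im (f x)).
Proof. by rewrite /expectationC unlock. Qed.

Lemma expectationC_cst P (k : R[i]) : expectationC P (fun=> k) = k.
Proof.
rewrite expectationCE; apply: eqC => /=; rewrite Rintegral_cst//.
  by rewrite (_ : fine _ = fine 1) ?mulr1//; congr fine; exact: probability_setT.
by rewrite (_ : fine _ = fine 1) ?mulr1//; congr fine; exact: probability_setT.
Qed.

Lemma expectationCD P f g : bmeasC f -> bmeasC g ->
  expectationC P (fun x => f x + g x) = expectationC P f + expectationC P g.
Proof.
move=> [f1 f2] [g1 g2]; rewrite !expectationCE; apply: eqC => /=.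
  rewrite -RintegralD//; [|exact: bmeas_integrable..].
  by apply: eq_Rintegral => x _; rewrite ReD.
rewrite -RintegralD//; [|exact: bmeas_integrable..].
by apply: eq_Rintegral => x _; rewrite ImD.
Qed.

Lemma expectationCZ P (k : R[i]) f : bmeasC f ->
  expectationC P (fun x => k * f x) = k * expectationC P f.
Proof.
move=> [f1 f2]; rewrite !expectationCE; apply: eqC; rewrite ?ReM ?ImM/=.
  rewrite -!RintegralZl//; [|exact: bmeas_integrable..].
  rewrite -RintegralB//; last 2 first.
    by apply: bmeas_integrable; apply: bmeasM => //; exact: bmeas_cst.
    by apply: bmeas_integrable; apply: bmeasM => //; exact: bmeas_cst.
  by apply: eq_Rintegral => x _; rewrite ReM.
rewrite -!RintegralZl//; [|exact: bmeas_integrable..].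
rewrite -RintegralD//; last 2 first.
  by apply: bmeas_integrable; apply: bmeasM => //; exact: bmeas_cst.
  by apply: bmeas_integrable; apply: bmeasM => //; exact: bmeas_cst.
by apply: eq_Rintegral => x _; rewrite ImM.
Qed.

Lemma expectationC_sum P (I : Type) (s : seq I) (f : I -> T -> R[i]) :
  (forall i, bmeasC (f i)) ->
  expectationC P (fun x => \sum_(i <- s) f i x) = \sum_(i <- s) expectationC P (f i).
Proof.
move=> bf; suff [] : bmeasC (fun x => \sum_(i <- s) f i x) /\
    expectationC P (fun x => \sum_(i <- s) f i x) = \sum_(i <- s) expectationC P (f i) by [].
elim: s => [|i s [bs IH]].
  rewrite big_nil; under eq_fun do rewrite big_nil.
  by split; [exact: bmeasC_cst|exact: expectationC_cst].
rewrite big_cons; under eq_fun do rewrite big_cons.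
by split; [exact: bmeasCD|rewrite expectationCD// IH].
Qed.

Lemma expectationC_real P (f : T -> R) : 
  expectationC P (fun x => (f x)%:C) = (\int[P]_x f x)%:C.
Proof.
rewrite expectationCE; apply: eqC => //=.
by rewrite Rintegral_cst// mul0r.
Qed.

(** Bounded pointwise convergence, taken on real and imaginary parts so that only limits in [R]
    occur. No measure appears: the means converge under any probability. *)
Definition bcvgC (f_ : nat -> T -> R[i]) f :=
  [/\ forall n, bmeasC (f_ n),
      exists M : R, forall n x,
        `|complex.Re (f_ n x)| <= M /\ `|complex.Im (f_ n x)| <= M,
      forall x, complex.Re (f_ n x) @[n --> \oo] --> complex.Re (f x) &
      forall x, complex.Im (f_ n x) @[n --> \oo] --> complex.Im (f x)].

Lemma bcvgC_mull h (f_ : nat -> T -> R[i]) f : bmeasC h -> bcvgC f_ f ->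
  bcvgC (fun n x => h x * f_ n x) (fun x => h x * f x).
Proof.
move=> bh [bf [M fM] f1 f2]; split.
- by move=> n; exact: bmeasCM.
- case: bh => [[_ [A hA]] [_ [B hB]]]; exists (A * M + B * M) => n x.
  have [a b] := fM n x; rewrite ReM ImM; split.
    rewrite (le_trans (ler_normB _ _))// !normrM lerD// ler_pM//.
  rewrite (le_trans (ler_normD _ _))// !normrM lerD// ler_pM//.
- move=> x; under eq_fun do rewrite ReM; rewrite ReM.
  by apply: cvgB; apply: cvgM => //; exact: cvg_cst.
- move=> x; under eq_fun do rewrite ImM; rewrite ImM.
  by apply: cvgD; apply: cvgM => //; exact: cvg_cst.
Qed.

Lemma bcvgC_expectation P (f_ : nat -> T -> R[i]) f : bcvgC f_ f ->
  complex.Re (expectationC P (f_ n)) @[n --> \oo] --> complex.Re (expectationC P f) /\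
  complex.Im (expectationC P (f_ n)) @[n --> \oo] --> complex.Im (expectationC P f).
Proof.
move=> [bf [M fM] f1 f2]; rewrite (expectationCE P f); split.
  under eq_fun do rewrite expectationCE/=.
  rewrite /=; apply: (@bounded_cvg_Rintegral _ _ _ P
    (fun n x => complex.Re (f_ n x)) _ M) => // [n|n x].
    exact: (bf n).1.
  exact: (fM n x).1.
under eq_fun do rewrite expectationCE/=.
rewrite /=; apply: (@bounded_cvg_Rintegral _ _ _ P
    (fun n x => complex.Im (f_ n x)) _ M) => // [n|n x].
    exact: (bf n).2.
  exact: (fM n x).2.
Qed.

End bounded_measurable_complex.

Lemma bmeas_comp (d d' : measure_display) (T : measurableType d)
    (T' : measurableType d') (R : realType) (X : T -> T') (f : T' -> R) :
  measurable_fun setT X -> bmeas f -> bmeas (f \o X).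
Proof.
move=> mX [mf [M fM]]; split; first exact: measurableT_comp.
by exists M => x; exact: fM.
Qed.

Lemma bmeasC_comp (d d' : measure_display) (T : measurableType d)
    (T' : measurableType d') (R : realType) (X : T -> T') (f : T' -> R[i]) :
  measurable_fun setT X -> bmeasC f -> bmeasC (f \o X).
Proof.
by move=> mX [f1 f2]; split; [exact: (bmeas_comp mX f1)|exact: (bmeas_comp mX f2)].
Qed.

Lemma bcvgC_eq_expectation (d d' : measure_display) (T : measurableType d)
    (T' : measurableType d') (R : realType) (P : probability T R)
    (P' : probability T' R) f_ f g_ g :
  bcvgC f_ f -> bcvgC g_ g ->
  (forall n, expectationC P (f_ n) = expectationC P' (g_ n)) ->
  expectationC P f = expectationC P' g.
Proof.
move=> ff gg fg.
have [f1 f2] := bcvgC_expectation P ff; have [g1 g2] := bcvgC_expectation P' gg.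
apply: eqC.
  rewrite -(cvg_lim _ f1)// -(cvg_lim _ g1)//.
  by congr (lim _); under eq_fun do rewrite fg.
rewrite -(cvg_lim _ f2)// -(cvg_lim _ g2)//.
by congr (lim _); under eq_fun do rewrite fg.
Qed.

(** * Change of variables under a complex weight *)

Section transfer.
Context {d d' : measure_display} {T : measurableType d} {T' : measurableType d'}
  {R : realType} (P : probability T R) (Q : probability T' R).
Variables (X : T -> T') (mX : measurable_fun setT X).

(** The hypothesis is the claim for indicators; both sides are linear in [f] and pass to bounded
    limits, so [bmeas_ind] applies. Since [h] may change sign, no image measure is formed from
    it. *)
Let weighted_transferR (h : T -> R) (c : R) : bmeas h ->
    (forall A, measurable A -> \int[P]_x (h x * \1_A (X x)) = c * fine (Q A)) ->
  forall f, bmeas f -> \int[P]_x (h x * f (X x)) = c * \int[Q]_x f x.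
Proof.
move=> bh h1.
have bhX f : bmeas f -> bmeas (fun x => h x * f (X x)).
  by move=> bf; apply: bmeasM => //; exact: (bmeas_comp mX bf).
apply: bmeas_ind => [A mA|f g a bf bg Ef Eg|f_ f M bf fM ff Ef].
- rewrite h1//; congr (_ * _); rewrite /Rintegral; congr fine.
  by rewrite integral_indic// setIT.
- have -> : (fun x => h x * (a * f (X x) + g (X x))) =
      (fun x => a * (h x * f (X x)) + h x * g (X x)).
    by apply/funext => x; ring.
  rewrite RintegralD//; last 2 first.
    by apply: bmeas_integrable; apply: bmeasM; [exact: bmeas_cst|exact: bhX].
    by apply: bmeas_integrable; exact: bhX.
  rewrite RintegralZl//; last by apply: bmeas_integrable; exact: bhX.
  rewrite RintegralD//; last 2 first.
    by apply: bmeas_integrable; apply: bmeasM => //; exact: bmeas_cst.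
    exact: bmeas_integrable.
  rewrite RintegralZl//; last exact: bmeas_integrable.
  by rewrite Ef Eg; ring.
- have c1 := bounded_cvg_Rintegral (P := Q) bf fM ff.
  have : \int[P]_x (h x * f_ n (X x)) @[n --> \oo] --> \int[P]_x (h x * f (X x)).
    have [_ [N hN]] := bh.
    apply: (@bounded_cvg_Rintegral _ _ _ P (fun n x => h x * f_ n (X x)) _ (N * M)).
    + by move=> n; exact: bhX.
    + by move=> n x; rewrite normrM ler_pM.
    + by move=> x; apply: cvgM; [exact: cvg_cst|exact: ff].
  move/cvg_lim => <- //; apply/cvg_lim => //.
  under eq_fun do rewrite Ef.
  by apply: cvgM => //; exact: cvg_cst.
Qed.

(** As [Q A] is real, the hypothesis splits into one real statement for Re h with constant Re c and
    one for Im h with constant Im c. *)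
Lemma expectationC_weighted_transfer (h : T -> R[i]) (c : R[i]) : bmeasC h ->
    (forall A, measurable A ->
       expectationC P (fun x => h x * (\1_A (X x))%:C) = c * (fine (Q A))%:C) ->
  forall f, bmeasC f ->
    expectationC P (fun x => h x * f (X x)) = c * expectationC Q f.
Proof.
move=> [h1 h2] hc f [f1 f2].
have c1 A : measurable A ->
    \int[P]_x (complex.Re (h x) * \1_A (X x)) = complex.Re c * fine (Q A).
  move=> mA; have := congr1 (@complex.Re R) (hc A mA).
  rewrite expectationCE ReM/= mulr0 subr0 => <-.
  by apply: eq_Rintegral => x _; rewrite ReM/= mulr0 subr0.
have c2 A : measurable A ->
    \int[P]_x (complex.Im (h x) * \1_A (X x)) = complex.Im c * fine (Q A).
  move=> mA; have := congr1 (@complex.Im R) (hc A mA).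
  rewrite expectationCE ImM/= mulr0 add0r => <-.
  by apply: eq_Rintegral => x _; rewrite ImM/= mulr0 add0r.
have bM (k : T -> R) (g : T' -> R) : bmeas k -> bmeas g ->
    P.-integrable setT (EFin \o (fun x => k x * g (X x))).
  move=> bk bg; apply: bmeas_integrable; apply: bmeasM => //.
  exact: (bmeas_comp mX bg).
rewrite !expectationCE; apply: eqC; rewrite ?ReM ?ImM/=.
  under eq_Rintegral do rewrite ReM.
  rewrite (RintegralB measurableT (bM _ _ h1 f1) (bM _ _ h2 f2)).
  by rewrite (weighted_transferR h1 c1 f1) (weighted_transferR h2 c2 f2).
under eq_Rintegral do rewrite ImM.
rewrite (RintegralD measurableT (bM _ _ h1 f2) (bM _ _ h2 f1)).
by rewrite (weighted_transferR h1 c1 f2) (weighted_transferR h2 c2 f1).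
Qed.

Lemma expectationC_transfer : (forall A, measurable A -> P (X @^-1` A) = Q A) ->
  forall f, bmeasC f -> expectationC P (f \o X) = expectationC Q f.
Proof.
move=> PQ f bf; rewrite -[RHS]mul1r -(@expectationC_weighted_transfer (fun=> 1))//.
- by congr expectationC; apply/funext => x; rewrite mul1r.
- exact: bmeasC_cst.
- move=> A mA; under eq_fun do rewrite mul1r.
  rewrite expectationC_real mul1r -PQ//; congr (_%:C); rewrite /Rintegral; congr fine.
  rewrite (_ : (fun _ => _) = (EFin \o \1_(X @^-1` A))) ?integral_indic ?setIT//.
  by rewrite -[X in measurable X]setTI; exact: mX.
Qed.

End transfer.

(** * Fubini and independence *)

Section fubini.
Context {d1 d2 : measure_display} {T1 : measurableType d1} {T2 : measurableType d2}
  {R : realType} (P1 : probability T1 R) (P2 : probability T2 R).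
Variables (F : T1 * T2 -> R[i]) (bF : bmeasC F).

Let fubiniR1 (f : T1 * T2 -> R) : bmeas f ->
  \int[P1]_x \int[P2]_y f (x, y) = \int[(P1 \x P2)%E]_z f z.
Proof.
move=> bf; rewrite /Rintegral -integral12_prod_meas1; last exact: bmeas_integrable.
congr fine; apply: eq_integral => x _; rewrite fineK//.
apply: integrable_fin_num => //; apply: (@bmeas_integrable _ _ _ P2 (fun y => f (x, y))).
by apply: (bmeas_comp _ bf).
Qed.

Let fubiniR2 (f : T1 * T2 -> R) : bmeas f ->
  \int[P2]_y \int[P1]_x f (x, y) = \int[(P1 \x P2)%E]_z f z.
Proof.
move=> bf; rewrite /Rintegral -integral21_prod_meas1; last exact: bmeas_integrable.
congr fine; apply: eq_integral => x _; rewrite fineK//.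
apply: integrable_fin_num => //; apply: (@bmeas_integrable _ _ _ P1 (fun y => f (y, x))).
by apply: (bmeas_comp _ bf).
Qed.

Let bmeas_fubini (f : T1 * T2 -> R) : bmeas f -> bmeas (fun x => \int[P2]_y f (x, y)).
Proof.
move=> bf; split.
  apply: measurableT_comp => //.
  apply: (@measurable_fubini_F _ _ _ _ _ P1 P2 (EFin \o f)).
  exact: bmeas_integrable.
have [_ [M fM]] := bf; exists M => x.
have bfx : bmeas (fun y => f (x, y)) by apply: (bmeas_comp _ bf).
rewrite (le_trans (le_normr_Rintegral _ _))//; first exact: bmeas_integrable.
have -> : M = \int[P2]_y cst M y.
  rewrite Rintegral_cst// (_ : fine _ = fine 1) ?mulr1//; congr fine.
  exact: probability_setT.
apply: le_Rintegral => //.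
- exact: (bmeas_integrable P2 (bmeas_norm bfx)).
- exact: (bmeas_integrable P2 (bmeas_cst M)).
Qed.

Lemma bmeasC_fubini : bmeasC (fun x => expectationC P2 (fun y => F (x, y))).
Proof.
case: bF => F1 F2; split.
  by under eq_fun do rewrite expectationCE/=; exact: (bmeas_fubini F1).
by under eq_fun do rewrite expectationCE/=; exact: (bmeas_fubini F2).
Qed.

Lemma expectationC_prod1 :
  expectationC P1 (fun x => expectationC P2 (fun y => F (x, y))) =
  expectationC (P1 \x P2)%E F.
Proof.
case: bF => F1 F2; rewrite !expectationCE; apply: eqC; rewrite /= -fubiniR1//.
- by apply: eq_Rintegral => x _; rewrite unlock.
- by apply: eq_Rintegral => x _; rewrite unlock.
Qed.

Lemma expectationC_prod2 :
  expectationC P2 (fun y => expectationC P1 (fun x => F (x, y))) =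
  expectationC (P1 \x P2)%E F.
Proof.
case: bF => F1 F2; rewrite !expectationCE; apply: eqC; rewrite /= -fubiniR2//.
- by apply: eq_Rintegral => x _; rewrite unlock.
- by apply: eq_Rintegral => x _; rewrite unlock.
Qed.

Lemma expectationC_fubini :
  expectationC P1 (fun x => expectationC P2 (fun y => F (x, y))) =
  expectationC P2 (fun y => expectationC P1 (fun x => F (x, y))).
Proof. by rewrite expectationC_prod1 expectationC_prod2. Qed.

End fubini.

(** This is conditioning on [X], with its value frozen at [X s]. Independence says that the law of
    the pair agrees with the product of the marginals on rectangles, hence everywhere; Fubini does
    the rest. *)
Lemma expectationC_independent (d d1 d2 : measure_display) (T : measurableType d)
    (T1 : measurableType d1) (T2 : measurableType d2) (R : realType)
    (P : probability T R) (X : {mfun T >-> T1}) (Y : {mfun T >-> T2})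
    (F : T1 * T2 -> R[i]) : independent2 P X Y -> bmeasC F ->
  expectationC P (fun t => F (X t, Y t)) =
  expectationC P (fun s => expectationC P (fun t => F (X s, Y t))).
Proof.
move=> XY bF.
pose Z t := (X t, Y t).
have mZ : measurable_fun setT Z by apply/measurable_fun_pairP; split.
pose Zm : {mfun T >-> (T1 * T2)%type} := mfun_Sub (mem_set mZ).
pose QX := distribution P X; pose QY := distribution P Y.
transitivity (expectationC (QX \x QY)%E F).
  apply: (expectationC_transfer mZ) => // A mA.
  transitivity (distribution P Zm A) => //; apply/esym.
  apply: (@product_measure_unique _ _ _ _ R QX QY) => // B C mB mC; exact: XY.
rewrite -expectationC_prod1//.
have <- : expectationC P ((fun x => expectationC QY (fun y => F (x, y))) \o X) =
    expectationC QX (fun x => expectationC QY (fun y => F (x, y))).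
  by apply: expectationC_transfer => //; exact: (bmeasC_fubini QX QY bF).
congr expectationC; apply/funext => s /=; apply/esym.
apply: (@expectationC_transfer _ _ _ _ _ P QY Y _ _ (fun y => F (X s, y))) => //.
by apply: (bmeasC_comp _ bF).
Qed.

(** * Extending a product formula to a larger class of factors *)

Section product_extension.
Context {d d' : measure_display} {T : measurableType d} {T' : measurableType d'}
  {R : realType} (P : probability T R) (n : nat).
Variables (X : 'I_n -> T -> T') (mX : forall j, measurable_fun setT (X j)).
Variables (F0 F1 : (T' -> R[i]) -> Prop) (Q : 'I_n -> (T' -> R[i]) -> R[i]).
Hypothesis F1b : forall f, F1 f -> bmeasC f.
Hypothesis F01 : forall f, F0 f -> F1 f.

(* The factors are moved from F0 to F1 one at a time, the other ones serving as
   the weight h. *)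
Lemma expectationC_prod_extension :
    (forall j h c, bmeasC h ->
       (forall f, F0 f -> expectationC P (fun t => h t * f (X j t)) = c * Q j f) ->
       forall f, F1 f -> expectationC P (fun t => h t * f (X j t)) = c * Q j f) ->
    (forall g, (forall j, F0 (g j)) ->
       expectationC P (fun t => \prod_j g j (X j t)) = \prod_j Q j (g j)) ->
  forall g, (forall j, F1 (g j)) ->
       expectationC P (fun t => \prod_j g j (X j t)) = \prod_j Q j (g j).
Proof.
move=> ext base g gF1.
(* Factors of index below [k] range over [F1], the others over [F0]: [k = 0] is the base formula and
   [k = n] the claim. *)
suff H k : forall g, (forall j, F1 (g j)) -> (forall j : 'I_n, (k <= j)%N -> F0 (g j)) ->
       expectationC P (fun t => \prod_j g j (X j t)) = \prod_j Q j (g j).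
  by apply: (H n) => // j; rewrite leqNgt ltn_ord.
elim: k => [|k IH] {gF1}g gF1 gF0; first by apply: base => j; exact: gF0.
have [nk|kn] := leqP n k.
  by apply: IH => // j kj; have := ltn_ord j; rewrite ltnNge (leq_trans nk kj).
pose j0 := Ordinal kn.
under eq_fun do rewrite (bigD1 j0)//= mulrC.
rewrite (bigD1 j0)//= mulrC.
apply: ext => //.
  by apply: bmeasC_prod => j; apply: (bmeasC_comp (mX j)); exact: F1b.
(* With an [F0] factor at place [k] the induction hypothesis applies. It yields the premise of
   [ext], where the constant [c] is the product of the other [Q j (g j)]. *)
move=> f fF0; pose g' j := if j == j0 then f else g j.
have g'j0 : g' j0 = f by rewrite /g' eqxx.
have g'E j : j != j0 -> g' j = g j by rewrite /g' => /negbTE ->.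
have -> : \prod_(j < n | j != j0) Q j (g j) * Q j0 f = \prod_j Q j (g' j).
  rewrite [RHS](bigD1 j0)//= g'j0 mulrC; congr (_ * _).
  by apply: eq_bigr => j /g'E ->.
have -> : (fun t => \prod_(j < n | j != j0) g j (X j t) * f (X j0 t)) =
    (fun t => \prod_j g' j (X j t)).
  apply/funext => t; rewrite [RHS](bigD1 j0)//= g'j0 mulrC; congr (_ * _).
  by apply: eq_bigr => j /g'E ->.
apply: IH.
  by move=> j; rewrite /g'; case: eqP => // _; exact: F01.
move=> j; rewrite leq_eqVlt => /orP[/eqP kj|kj].
  by rewrite (_ : j = j0) ?g'j0//; apply: val_inj.
have jj0 : j != j0 by apply/eqP => jj0; rewrite jj0 ltnn in kj.
by rewrite g'E//; exact: gF0.
Qed.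

End product_extension.

(** * Uniqueness of Laplace transforms *)

Section laplace.
Context {R : realType}.
Implicit Types (a y z g : R).

(** With u = y / m, the bounds 1 - u <= exp(-u) <= 1 / (1 + u) <= 1 - u + u^2 place m (1 - exp(-u))
    between y - y^2 / m and y. *)
Lemma cvg_onem_expR y : 0 <= y ->
  n.+1%:R * (1 - expR (- (n.+1%:R^-1 * y))) @[n --> \oo] --> y.
Proof.
move=> y0.
apply: (@squeeze_cvgr _ _ _ _ (fun n => y - y ^+ 2 / n.+1%:R) (fun=> y)).
- near=> n; have m0 : 0 < n.+1%:R :> R by rewrite ltr0n.
  set m := n.+1%:R in m0 *; pose u := m^-1 * y.
  have u0 : 0 <= u by rewrite mulr_ge0// invr_ge0 ltW.
  have yE : y = m * u by rewrite /u mulrA divff ?mul1r// gt_eqF.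
  rewrite -/u yE exprMn.
  have -> : m ^+ 2 * u ^+ 2 / m = m * u ^+ 2 by field; rewrite gt_eqF.
  rewrite -mulrBr !ler_pM2l//; apply/andP; split; last first.
    by have := expR_ge1Dx (- u); lra.
  have : expR (- u) <= (1 + u)^-1.
    by rewrite expRN lef_pV2 ?posrE ?expR_gt0 ?expR_ge1Dx//; lra.
  have : (1 + u)^-1 <= 1 - u + u ^+ 2.
    rewrite -[leLHS]mul1r ler_pdivrMr; last by lra.
    by have := exprn_ge0 3 u0; rewrite !exprS expr0; nra.
  by lra.
- rewrite -[X in _ --> X]subr0; apply: cvgB; first exact: cvg_cst.
  rewrite -(mulr0 (y ^+ 2)); apply: cvgM; first exact: cvg_cst.
  exact: cvg_harmonic.
- exact: cvg_cst.
Unshelve. all: by end_near. Qed.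

(** Termwise comparison with the exponential series at |z|. The bound is uniform in [n], which
    provides the dominating constant for the partial sums below. *)
Lemma normr_series_cos_le z n : `|series (cos_coeff z) n| <= expR `|z|.
Proof.
rewrite (le_trans (ler_norm_sum _ _ _))//.
apply: (@le_trans _ _ (series (exp_coeff `|z|) n)).
  apply: ler_sum => k _; rewrite /cos_coeff /exp_coeff/=.
  rewrite !normrM normfV !normr_nat !normrX normrN normr1 expr1n mulr1.
  by case: odd; rewrite ?mul1r// !mul0r divr_ge0.
apply: nondecreasing_cvgn_le; last exact: is_cvg_series_exp_coeff.
by apply/nondecreasing_seqP => k; rewrite /series/= big_nat_recr//= lerDl exp_coeff_ge0.
Qed.

Lemma normr_series_sin_le z n : `|series (sin_coeff z) n| <= expR `|z|.
Proof.
rewrite (le_trans (ler_norm_sum _ _ _))//.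
apply: (@le_trans _ _ (series (exp_coeff `|z|) n)).
  apply: ler_sum => k _; rewrite /sin_coeff /exp_coeff/=.
  rewrite !normrM normfV !normr_nat !normrX normrN normr1 expr1n mulr1.
  by case: odd; rewrite ?mul1r// !mul0r divr_ge0.
apply: nondecreasing_cvgn_le; last exact: is_cvg_series_exp_coeff.
by apply/nondecreasing_seqP => k; rewrite /series/= big_nat_recr//= lerDl exp_coeff_ge0.
Qed.

End laplace.

Section laplace_bcvg.
Context {d : measure_display} {T : measurableType d} {R : realType}.
Variables (Y : T -> R) (mY : measurable_fun setT Y) (Y0 : forall t, 0 <= Y t).

Let cis_bound (a : R) : `|complex.Re (cis a)| <= 1 /\ `|complex.Im (cis a)| <= 1.
Proof. by rewrite cisE cos_max sin_max. Qed.

Lemma bcvgC_cis_onem_expR (a : R) :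
  bcvgC (fun n t => cis (a * (n.+1%:R * (1 - expR (- (n.+1%:R^-1 * Y t))))))
        (fun t => cis (a * Y t)).
Proof.
split.
- move=> n; apply: bmeasC_cis; apply: measurable_funM => //; apply: measurable_funM => //.
  apply: measurable_funB => //; apply: measurableT_comp => //.
  by apply: measurable_funN; exact: measurable_funM.
- by exists 1 => n t; exact: cis_bound.
- move=> t; under eq_fun do rewrite cisE/=; rewrite cisE/=.
  apply: (@continuous_cvg _ _ _ _ _ _ (@cos R)); first exact: continuous_cos.
  by apply: cvgM; [exact: cvg_cst|exact: cvg_onem_expR].
- move=> t; under eq_fun do rewrite cisE/=; rewrite cisE/=.
  apply: (@continuous_cvg _ _ _ _ _ _ (@sin R)); first exact: continuous_sin.
  by apply: cvgM; [exact: cvg_cst|exact: cvg_onem_expR].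
Qed.

(** The term (iz)^k / k! of the exponential series: even [k] contributes to the real part, odd [k]
    to the imaginary part. *)
Let cis_coef (z : R) k : R[i] := cos_coeff z k +i* sin_coeff z k.

(** A bound M on |G| makes exp(|z| M) dominate all partial sums. An unbounded variable would give no
    such constant, whence the detour through n (1 - exp(-Y/n)) in the uniqueness argument. *)
Lemma bcvgC_cis_series (z : R) (G : T -> R) : bmeas G ->
  bcvgC (fun n t => \sum_(k < n) cis_coef z k * (G t ^+ k)%:C) (fun t => cis (z * G t)).
Proof.
move=> [mG [M GM]].
have coefE t k : cis_coef z k * (G t ^+ k)%:C = cis_coef (z * G t) k.
  by apply: eqC; rewrite ?ReM ?ImM/= mulr0 ?subr0 ?add0r /cos_coeff /sin_coeff/= exprMn; ring.
have ReE n t : complex.Re (\sum_(k < n) cis_coef z k * (G t ^+ k)%:C) =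
    series (cos_coeff (z * G t)) n.
  rewrite /series/= big_mkord (big_morph (@complex.Re R) (id1 := 0) (op1 := +%R))//.
    by apply: eq_bigr => k _; rewrite coefE.
  exact: ReD.
have ImE n t : complex.Im (\sum_(k < n) cis_coef z k * (G t ^+ k)%:C) =
    series (sin_coeff (z * G t)) n.
  rewrite /series/= big_mkord (big_morph (@complex.Im R) (id1 := 0) (op1 := +%R))//.
    by apply: eq_bigr => k _; rewrite coefE.
  exact: ImD.
have le t : expR `|z * G t| <= expR (`|z| * M) by rewrite ler_expR normrM ler_wpM2l.
have bnd n t : `|series (cos_coeff (z * G t)) n| <= expR (`|z| * M) /\
               `|series (sin_coeff (z * G t)) n| <= expR (`|z| * M).
  by split; rewrite (le_trans _ (le t))// ?normr_series_cos_le ?normr_series_sin_le.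
have mcoef (c : nat -> R) n : measurable_fun setT (fun t => \sum_(k < n) c k * G t ^+ k).
  apply: measurable_sum => k; apply: measurable_funM => //.
  exact: measurable_funX.
split.
- move=> n; split; (split; last by exists (expR (`|z| * M)) => t; rewrite ?ReE ?ImE; have [] := bnd n t).
    under eq_fun do rewrite ReE /series/= big_mkord.
    rewrite (_ : (fun _ => _) = fun t => \sum_(k < n) cos_coeff z k * G t ^+ k); first exact: mcoef.
    apply/funext => t; apply: eq_bigr => k _.
    by rewrite /cos_coeff/= exprMn; ring.
  under eq_fun do rewrite ImE /series/= big_mkord.
  rewrite (_ : (fun _ => _) = fun t => \sum_(k < n) sin_coeff z k * G t ^+ k); first exact: mcoef.
  apply/funext => t; apply: eq_bigr => k _.
  by rewrite /sin_coeff/= exprMn; ring.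
- by exists (expR (`|z| * M)) => n t; rewrite ReE ImE.
- move=> t; under eq_fun do rewrite ReE; rewrite cisE/= unlock.
  exact: is_cvg_series_cos_coeff.
- move=> t; under eq_fun do rewrite ImE; rewrite cisE/= unlock.
  exact: is_cvg_series_sin_coeff.
Qed.

End laplace_bcvg.

(* exp(iaY) is the bounded limit of exp(ian(1 - exp(-Y/n))), which is itself a
   bounded limit of linear combinations of the exp(-kY/n). *)
Lemma laplace_unique (d d' : measure_display) (T : measurableType d)
    (T' : measurableType d') (R : realType) (P : probability T R)
    (P' : probability T' R) (h : T -> R[i]) (h' : T' -> R[i]) (Y : T -> R) (Y' : T' -> R) :
    bmeasC h -> bmeasC h' ->
    measurable_fun setT Y -> measurable_fun setT Y' ->
    (forall t, 0 <= Y t) -> (forall t, 0 <= Y' t) ->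
    (forall s, 0 <= s ->
       expectationC P (fun t => h t * (expR (- (s * Y t)))%:C) =
       expectationC P' (fun t => h' t * (expR (- (s * Y' t)))%:C)) ->
  forall a, expectationC P (fun t => h t * cis (a * Y t)) =
       expectationC P' (fun t => h' t * cis (a * Y' t)).
Proof.
move=> bh bh' mY mY' Y0 Y'0 PP' a.
apply: (bcvgC_eq_expectation (bcvgC_mull bh (bcvgC_cis_onem_expR mY Y0 a))
  (bcvgC_mull bh' (bcvgC_cis_onem_expR mY' Y'0 a))) => n.
pose m : R := n.+1%:R; pose G t := expR (- (m^-1 * Y t)).
pose G' t := expR (- (m^-1 * Y' t)).
have m0 : 0 <= m^-1 by rewrite invr_ge0 ler0n.
have bG : bmeas G by apply: bmeas_expRN => [|t]; [exact: measurable_funM|exact: mulr_ge0].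
have bG' : bmeas G' by apply: bmeas_expRN => [|t]; [exact: measurable_funM|exact: mulr_ge0].
(* The phase exp(iam) is constant and leaves the mean; what remains is an exponential of the bounded
   [G], ready for its power series. *)
have cisB g : cis (a * (m * (1 - g))) = cis (a * m) * cis (- (a * m) * g).
  by rewrite -cisD; congr cis; ring.
under eq_fun do rewrite cisB mulrCA.
under [in RHS]eq_fun do rewrite cisB mulrCA.
have bZ := bmeasC_cis (measurable_funM (measurable_cst (- (a * m))) bG.1).
have bZ' := bmeasC_cis (measurable_funM (measurable_cst (- (a * m))) bG'.1).
rewrite (expectationCZ _ _ (bmeasCM bh bZ)) (expectationCZ _ _ (bmeasCM bh' bZ')).
congr (_ * _).
apply: (bcvgC_eq_expectation (bcvgC_mull bh (bcvgC_cis_series _ bG))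
  (bcvgC_mull bh' (bcvgC_cis_series _ bG'))) => N.
under eq_fun do rewrite mulr_sumr.
under [in RHS]eq_fun do rewrite mulr_sumr.
have bX k : bmeas (fun t => G t ^+ k).
  under eq_fun do rewrite -expRM_natl mulrN mulrA.
  apply: bmeas_expRN => [|t]; first exact: measurable_funM.
  by rewrite !mulr_ge0.
have bX' k : bmeas (fun t => G' t ^+ k).
  under eq_fun do rewrite -expRM_natl mulrN mulrA.
  apply: bmeas_expRN => [|t]; first exact: measurable_funM.
  by rewrite !mulr_ge0.
have bhX k := bmeasCM bh (bmeasC_real (bX k)).
have bhX' k := bmeasCM bh' (bmeasC_real (bX' k)).
rewrite !expectationC_sum; last 2 first.
- by move=> k; apply: bmeasCM => //; apply: bmeasCM; [exact: bmeasC_cst|exact: bmeasC_real].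
- by move=> k; apply: bmeasCM => //; apply: bmeasCM; [exact: bmeasC_cst|exact: bmeasC_real].
apply: eq_bigr => k _.
under eq_fun do rewrite mulrCA.
under [in RHS]eq_fun do rewrite mulrCA.
rewrite !expectationCZ//; congr (_ * _).
(* Powers of exp(-Y/m) are again Laplace kernels: the hypothesis is applied at s = k / m, including
   s = 0 for k = 0. *)
under eq_fun do rewrite /G -expRM_natl mulrN mulrA.
under [in RHS]eq_fun do rewrite /G' -expRM_natl mulrN mulrA.
by apply: PP'; rewrite mulr_ge0.
Qed.

(** * Principal powers *)

Section principal_power.
Context {R : realType}.
Implicit Types (z w : R[i]).

Lemma absC_gt0 z : 0 < complex.Re z -> 0 < absC z.
Proof.
by move=> z0; rewrite sqrtr_gt0 ltr_pwDl ?exprn_gt0 ?sqr_ge0.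
Qed.

(** The sign test in [argC] restores the sign that sin (acos x) = sqrt (1 - x^2) loses. The third
    conclusion selects the branch of square roots: acos of a positive number is below pi, so half
    the argument lies in ]-pi/2, pi/2[. *)
Lemma cos_sin_argC z : 0 < complex.Re z ->
  [/\ absC z * cos (argC z) = complex.Re z, absC z * sin (argC z) = complex.Im z
    & 0 < cos (argC z / 2)].
Proof.
move=> z0; have r0 := absC_gt0 z0; set r := absC z in r0 *.
have rE : r ^+ 2 = complex.Re z ^+ 2 + complex.Im z ^+ 2.
  by rewrite sqr_sqrtr// addr_ge0 ?sqr_ge0.
set x := complex.Re z / r.
have x0 : 0 < x by rewrite divr_gt0.
have x1 : x <= 1.
  rewrite ler_pdivrMr// mul1r -ler_sqr ?nnegrE ?(ltW z0) ?(ltW r0)//.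
  by rewrite rE lerDl sqr_ge0.
have x01 : -1 <= x <= 1 by rewrite x1 andbT; lra.
have cosE : cos (acos x) = x by rewrite acosK// in_itv.
have sinE : r * sin (acos x) = `|complex.Im z|.
  rewrite sin_acos// -(ger0_norm (ltW r0)) -sqrtr_sqr -sqrtrM ?sqr_ge0//.
  rewrite mulrBr mulr1 expr_div_n mulrCA divff ?mulr1 ?rE; last first.
    by rewrite -rE expf_eq0/= gt_eqF.
  by rewrite addrC addKr sqrtr_sqr.
have a0 := acos_ge0 x01.
have api : acos x < pi by apply: acos_ltpi; rewrite x1 andbT; lra.
rewrite /argC -/r -/x; case: ifPn => Im0; rewrite ?cosN ?sinN cosE; split.
- by rewrite mulrC divfK// gt_eqF.
- by rewrite sinE ger0_norm.
- by apply: cos_gt0_pihalf; lra.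
- by rewrite mulrC divfK// gt_eqF.
- by rewrite mulrN sinE ltr0_norm ?opprK// ltNge.
- by apply: cos_gt0_pihalf; lra.
Qed.

Lemma expC_logC z : 0 < complex.Re z -> expC (logC z) = z.
Proof.
move=> z0; have [c s _] := cos_sin_argC z0.
by apply: eqC; rewrite /= lnK ?posrE ?absC_gt0// ?c ?s.
Qed.

Lemma real_complexM (a b : R) : (a * b)%:C = a%:C * b%:C.
Proof. by apply: eqC; rewrite ?ReM ?ImM/= !(mulr0, mul0r) ?subr0 ?addr0. Qed.

Lemma real_complex_nat (n : nat) : (n%:R : R)%:C = n%:R.
Proof.
elim: n => [//|n IH]; rewrite -[RHS]natr1 -IH; apply: eqC.
  by rewrite ReD -natr1.
by rewrite ImD /= addr0.
Qed.

(** The number v = exp(log z / 2) is a square root of z with Re v > 0, its argument being half that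
    of z. The only other root is -v, so v = w. The exponent n / 2 then gives v^n by additivity of
    the exponential, with no further choice of branch. *)
Lemma powC_half_sqrt z w (n : nat) : 0 < complex.Re z -> 0 < complex.Re w ->
  w ^+ 2 = z -> powC z (n%:R / 2) = w ^+ n.
Proof.
move=> z0 w0 wz.
rewrite /powC real_complexM real_complex_nat -mulrA expCX; congr (_ ^+ _).
set v := expC _.
have v2 : v ^+ 2 = z.
  rewrite -expCX mulrA -[RHS]expC_logC//; congr expC.
  rewrite -real_complex_nat -real_complexM divff ?pnatr_eq0//.
  exact: mul1r.
have v0 : 0 < complex.Re v.
  have [_ _ c] := cos_sin_argC z0.
  have aE : complex.Im ((2^-1)%:C * logC z) = argC z / 2.
    by rewrite ImM mul0r addr0 mulrC.
  by rewrite -[complex.Re _]/(expR _ * cos _) aE mulr_gt0 ?expR_gt0.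
have /eqP : (v - w) * (v + w) = 0 by rewrite -subr_sqr v2 wz subrr.
rewrite mulf_eq0 subr_eq0 => /orP[/eqP//|/eqP vw].
have := congr1 (@complex.Re R) vw; rewrite ReD => h.
by have : 0 < complex.Re v + complex.Re w; [exact: addr_gt0|rewrite h ltxx].
Qed.

End principal_power.

(** * Normal and exponential laws *)

Section density.
Context {d : measure_display} {T : measurableType d} {R : realType}
  (mu : {measure set T -> \bar R}) (nu : probability T R).
Variable w : T -> R.
Hypothesis w0 : forall x, 0 <= w x.
Hypothesis iw : mu.-integrable setT (EFin \o w).
Hypothesis nuE : forall A, measurable A -> nu A = (\int[mu]_(x in A) (w x)%:E)%E.

Lemma bmeas_integrable_mull f : bmeas f ->
  mu.-integrable setT (EFin \o (fun x => f x * w x)).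
Proof.
move=> [mf [M fM]].
have mw : measurable_fun setT w by have /integrableP[/measurable_EFinP] := iw.
apply: (@le_integrable _ _ _ _ _ measurableT _ (EFin \o (fun x => M * w x))).
- by apply/measurable_EFinP; exact: measurable_funM.
- move=> x _; rewrite /= lee_fin !normrM ler_wpM2r ?normr_ge0//.
  exact: le_trans (fM x) (ler_norm _).
- by under [EFin \o _]eq_fun do rewrite /= EFinM; exact: integrableZl.
Qed.

(** Again [bmeas_ind]. As [mu] may be infinite, the limit on the right is dominated by the
    integrable M w and not by a constant. *)
Lemma Rintegral_density f : bmeas f ->
  \int[nu]_x f x = \int[mu]_x (f x * w x).
Proof.
move: f; apply: bmeas_ind => [A mA|f g a bf bg Ef Eg|f_ f M bf fM ff Ef].
- transitivity (fine (nu A)); first by rewrite /Rintegral integral_indic// setIT.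
  rewrite nuE// /Rintegral; congr fine.
  rewrite integral_mkcond; apply: eq_integral => x _.
  by rewrite patchE indicE; case: (x \in A); rewrite ?mul1r ?mul0r.
- have ba : bmeas (fun x => a * f x) := bmeasM (bmeas_cst a) bf.
  rewrite (RintegralD measurableT (bmeas_integrable nu ba) (bmeas_integrable nu bg)).
  rewrite (RintegralZl a measurableT (bmeas_integrable nu bf)) Ef Eg.
  rewrite -(RintegralZl a measurableT (bmeas_integrable_mull bf)).
  have ia : mu.-integrable setT (EFin \o (fun x => a * (f x * w x))).
    have := bmeas_integrable_mull ba; congr integrable.
    by apply/funext => x /=; rewrite mulrA.
  rewrite -(RintegralD measurableT ia (bmeas_integrable_mull bg)).
  by apply: eq_Rintegral => x _; rewrite mulrDl mulrA.
- have bl := bmeas_cvg bf fM ff.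
  have c1 := bounded_cvg_Rintegral (P := nu) bf fM ff.
  rewrite -(cvg_lim _ c1)//; apply/cvg_lim => //.
  under eq_fun do rewrite Ef.
  have il := bmeas_integrable_mull bl.
  apply: fine_cvg; rewrite fineK; last exact: integrable_fin_num.
  apply: (@dominated_cvg _ _ _ mu setT measurableT (fun n x => (f_ n x * w x)%:E) _
    (EFin \o (fun x => M * w x))).
  + by move=> n; have /integrableP[] := bmeas_integrable_mull (bf n).
  + by move=> x _; apply: cvg_EFin; [exact: nearW|apply: cvgM; [exact: ff|exact: cvg_cst]].
  + by [].
  + by under [EFin \o _]eq_fun do rewrite /= EFinM; exact: integrableZl.
  + move=> n x _; rewrite /= lee_fin normrM (ger0_norm (w0 x)) ler_wpM2r//.
Qed.

End density.

(** * Primitives on unbounded intervals *)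

Section improper_FTC.
Context {R : realType}.
Notation mu := (@lebesgue_measure R).

(** The fundamental theorem on each [a n, b n], followed by dominated convergence with |f| as
    dominating function, since the intervals eventually contain each point of D. The line and the
    half-line are the two cases of interest. *)
Lemma improper_FTC (D : set R) (f F : R -> R) (a b : nat -> R) (l : R) :
    measurable D -> (forall n, a n < b n) -> (forall n, `[a n, b n] `<=` D) ->
    (forall x, D x -> \forall n \near \oo, a n <= x <= b n) ->
    mu.-integrable D (EFin \o f) -> continuous f ->
    (forall x, is_derive x (1 : R) F (f x)) ->
    F (b n) - F (a n) @[n --> \oo] --> l ->
  \int[mu]_(x in D) f x = l.
Proof.
move=> mD ab abD Dab fi fc dF Fl.
have cF : continuous F.
  by move=> x; apply: differentiable_continuous; apply/derivable1_diffP; have [] := dF x.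
have EI n : \int[mu]_(x in D) (f x * \1_(`[a n, b n]) x) = F (b n) - F (a n).
  rewrite /Rintegral.
  have -> : (F (b n) - F (a n)) = fine ((F (b n))%:E - (F (a n))%:E)%E by [].
  congr fine; rewrite -(@continuous_FTC2 _ f F (a n) (b n) (ab n)).
  - rewrite [RHS]integral_mkcond [LHS]integral_mkcond.
    apply: eq_integral => x _; rewrite !patchE indicE.
    have [xab|xab] := boolP (x \in `[a n, b n]%classic).
      by rewrite mulr1 mem_set//; apply: abD (set_mem xab).
    by rewrite mulr0; case: ifP.
  - by apply: continuous_subspaceT.
  - split.
    + by move=> x _; have [] := dF x.
    + by apply: cvg_at_right_filter; exact: cF.
    + by apply: cvg_at_left_filter; exact: cF.
  - by move=> x _; rewrite derive1E; apply: derive_val.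
rewrite -(cvg_lim _ Fl)//; apply/esym/cvg_lim => //.
under eq_fun do rewrite -EI.
apply: fine_cvg; rewrite fineK; last exact: integrable_fin_num.
have mf : measurable_fun setT f by exact: continuous_measurable_fun.
apply: (@dominated_cvg _ _ _ mu D mD (fun n x => (f x * \1_(`[a n, b n]) x)%:E) _
    (EFin \o (fun x => `|f x|))).
- move=> n; apply/measurable_EFinP; apply: measurable_funTS.
  by apply: measurable_funM => //.
- move=> x Dx; apply: cvg_EFin; first exact: nearW.
  apply: cvg_near_cst; have := Dab _ Dx; apply: filterS => n xab.
  by rewrite /= indicE mem_set/= ?mulr1// in_itv.
- by [].
- exact: integrable_norm.
- move=> n x _; rewrite lee_fin normrM indicE.
  by case: (_ \in _); rewrite ?normr1 ?normr0 ?mulr1 ?mulr0.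
Qed.

End improper_FTC.

Section derivatives.
Context {R : realType}.
Implicit Types (b c x : R).

Lemma is_derive_affine b c x : is_derive x (1 : R) (fun t => c * t + b) c.
Proof.
have := is_deriveD (is_deriveZ c (is_derive_id x (1 : R))) (is_derive_cst b x (1 : R)).
by rewrite addr0 => /is_derive_eq; apply; rewrite /GRing.scale/= mulr1.
Qed.

Lemma is_derive_cos_affine b c x :
  is_derive x (1 : R) (fun t => cos (c * t + b)) (- sin (c * x + b) * c).
Proof. exact: (is_derive1_comp (is_derive_cos _) (is_derive_affine b c x)). Qed.

Lemma is_derive_sin_affine b c x :
  is_derive x (1 : R) (fun t => sin (c * t + b)) (cos (c * x + b) * c).
Proof. exact: (is_derive1_comp (is_derive_sin _) (is_derive_affine b c x)). Qed.

Lemma is_derive_expR_sqr c x :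
  is_derive x (1 : R) (fun t => expR (c * t ^+ 2)) (2 * c * x * expR (c * x ^+ 2)).
Proof.
have h : is_derive x (1 : R) (fun t : R => c * t ^+ 2) (2 * c * x).
  have := is_deriveZ c (is_deriveX 2 (is_derive_id x (1 : R))).
  by move/is_derive_eq; apply; rewrite /GRing.scale/=; ring.
by apply: (is_derive_eq (is_derive1_comp (is_derive_expR _) h)); ring.
Qed.

Lemma is_derive_mul (f g : R -> R) x (df dg : R) :
  is_derive x (1 : R) f df -> is_derive x (1 : R) g dg ->
  is_derive x (1 : R) (fun t => f t * g t) (df * g x + f x * dg).
Proof.
move=> hf hg; apply: (is_derive_eq (is_deriveM hf hg)).
by rewrite /GRing.scale/=; ring.
Qed.

End derivatives.

(** * Laplace transform of the square and characteristic function of the normal law *)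

Section normal_law.
Context {R : realType}.
Notation mu := (@lebesgue_measure R).

Lemma Rintegral_normal_prob (m s : R) (f : R -> R) : bmeas f ->
  \int[normal_prob m s]_x f x = \int[mu]_x (f x * normal_pdf m s x).
Proof.
move=> bf; apply: (@Rintegral_density _ _ _ mu (normal_prob m s)) => //.
- by move=> x; exact: normal_pdf_ge0.
- exact: integrable_normal_pdf.
Qed.

Lemma measurable_sqr : measurable_fun setT (fun x : R => x ^+ 2).
Proof. exact: measurable_funX. Qed.

(** Multiplying the standard density by exp(-t x^2) gives [s] times the density of variance s^2 = 1
    / (1 + 2t), of total mass 1. *)
Lemma normal_laplace_sqr (t : R) : 0 <= t ->
  \int[normal_prob 0 1]_x expR (- (t * x ^+ 2)) = (Num.sqrt (1 + 2 * t))^-1.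
Proof.
move=> t0; set s := (Num.sqrt _)^-1.
have q0 : 0 < 1 + 2 * t by lra.
have s0 : 0 < s by rewrite invr_gt0 sqrtr_gt0.
have s2 : s ^+ 2 = (1 + 2 * t)^-1 by rewrite exprVn sqr_sqrtr// ltW.
rewrite Rintegral_normal_prob; last first.
  apply: bmeas_expRN => [|x]; last by rewrite mulr_ge0 ?sqr_ge0.
  by apply: measurable_funM => //; exact: measurable_sqr.
have E x : expR (- (t * x ^+ 2)) * normal_pdf 0 1 x = s * normal_pdf 0 s x.
  rewrite !normal_pdfE ?oner_eq0 ?gt_eqF// /normal_fun /normal_peak.
  rewrite s2 subr0 mulrCA -expRD mulrA; congr (_ * expR _).
    rewrite expr1n mul1r -mulrnAr sqrtrM ?invr_ge0 ?ltW//.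
    by rewrite sqrtrV ?(ltW q0)// -/s invfM mulrA mulfV ?mul1r// gt_eqF.
  by rewrite expr1n -[_ *+ 2]mulr_natr -[1 *+ 2]mulr_natr; field; rewrite gt_eqF.
under eq_Rintegral do rewrite E.
rewrite RintegralZl//; last exact: integrable_normal_pdf.
by rewrite /Rintegral integral_normal_pdf mulr1.
Qed.

Section char_fun.
Variables (s : R) (s0 : 0 < s).
Let pdf := normal_pdf 0 s.

Let pdfE x : pdf x = normal_peak s * expR (- (x ^+ 2 / (s ^+ 2 *+ 2))).
Proof.
by rewrite /pdf normal_pdfE ?gt_eqF// /normal_fun subr0 mulNr.
Qed.

Let peak_gt0 : 0 < normal_peak s. Proof. by rewrite normal_peak_gt0 ?gt_eqF. Qed.

(** Put v = x^2 / (4 s^2), so that the Gaussian factor is exp(-2v). Half of it absorbs |x|, because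
    |x| <= 2s (1 + v) <= 2s exp(v); the other half is a Gaussian of variance 2 s^2. Hence |x| times
    the density is both bounded and integrable. *)
Let moment x :
  `|x| * pdf x <= 2 * s * normal_peak s *
    expR (- (x ^+ 2 / ((Num.sqrt 2 * s) ^+ 2 *+ 2))).
Proof.
rewrite pdfE exprMn sqr_sqrtr//; set v := x ^+ 2 / (2 * s ^+ 2 *+ 2).
have -> : x ^+ 2 / (s ^+ 2 *+ 2) = v + v.
  by rewrite /v -mulr_natr -[_ *+ 2]mulr_natr; field; rewrite gt_eqF.
rewrite opprD expRD mulrCA [2 * s * _]mulrC -!mulrA ler_pM2l// mulrA -[leRHS]mulrA.
rewrite !mulrA ler_pM2r ?expR_gt0//.
rewrite expRN ler_pdivrMr ?expR_gt0//.
have h1 := expR_ge1Dx v.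
have : `|x| <= 2 * s * (1 + v).
  have -> : v = (`|x| / (2 * s)) ^+ 2.
    rewrite expr_div_n real_normK ?num_real// /v -[_ *+ 2]mulr_natr.
    by field; rewrite gt_eqF.
  set u := `|x| / _.
  have -> : `|x| = 2 * s * u by rewrite /u mulrC divfK// gt_eqF// mulr_gt0.
  by rewrite ler_pM2l ?mulr_gt0//; have := sqr_ge0 (u - 1); nra.
move=> /le_trans; apply; rewrite ler_pM2l ?mulr_gt0//.
Qed.

Let moment_bound x : `|x| * pdf x <= 2 * s * normal_peak s.
Proof.
rewrite (le_trans (moment x))// -[leRHS]mulr1 ler_wpM2l//.
  by rewrite !mulr_ge0// ltW.
by rewrite -expR0 ler_expR oppr_le0 mulr_ge0 ?sqr_ge0// invr_ge0 mulrn_wge0 ?sqr_ge0.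
Qed.

Let integrable_moment : mu.-integrable setT (EFin \o (fun x => `|x| * pdf x)).
Proof.
set s' := Num.sqrt 2 * s.
have s'0 : 0 < s' by rewrite mulr_gt0 ?sqrtr_gt0.
pose c := 2 * s * normal_peak s / normal_peak s'.
have mpdf : measurable_fun setT pdf by exact: measurable_normal_pdf.
apply: (@le_integrable _ _ _ mu _ measurableT _ (EFin \o (fun x => c * normal_pdf 0 s' x))).
- apply/measurable_EFinP; exact: measurable_funM.
- move=> x _; rewrite /= lee_fin ger0_norm ?mulr_ge0 ?normal_pdf_ge0//.
  rewrite (le_trans (moment x))// (le_trans _ (ler_norm _))//.
  rewrite normal_pdfE ?gt_eqF// /normal_fun subr0 mulNr mulrA /c divfK//.
  by rewrite gt_eqF// normal_peak_gt0 ?gt_eqF.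
- under [EFin \o _]eq_fun do rewrite /= EFinM.
  by apply: integrableZl => //; exact: integrable_normal_pdf.
Qed.

Let pdf_derive x : is_derive x (1 : R) pdf (- (x / s ^+ 2) * pdf x).
Proof.
have -> : pdf = fun t => normal_peak s * expR (- (s ^+ 2 *+ 2)^-1 * t ^+ 2).
  by apply/funext => t; rewrite pdfE mulNr [X in _ = _ * expR (- X)]mulrC.
apply: (is_derive_eq (is_derive_mul (is_derive_cst (normal_peak s) x 1) (is_derive_expR_sqr _ x))).
rewrite /cst; set e := expR _; move: (normal_peak s) => k.
by rewrite -[s ^+ 2 *+ 2]mulr_natr; field; rewrite gt_eqF.
Qed.

Let cpdf : continuous pdf.
Proof. by apply: continuous_normal_pdf; rewrite gt_eqF. Qed.

Let pdf_cvg0 (g : nat -> R) : (forall n, `|g n| = n.+1%:R) -> pdf (g n) @[n --> \oo] --> 0.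
Proof.
move=> gn; apply: (@squeeze_cvgr _ _ _ _ (fun=> 0) (fun n => 2 * s * normal_peak s * n.+1%:R^-1)).
- apply: nearW => n; rewrite normal_pdf_ge0/= ler_pdivlMr ?ltr0n// mulrC -gn.
  exact: moment_bound.
- exact: cvg_cst.
- rewrite -(mulr0 (2 * s * normal_peak s)); apply: cvgM; first exact: cvg_cst.
  exact: cvg_harmonic.
Qed.

Let cos_affineC (t b : R) : continuous (fun x : R => cos (t * x + b)).
Proof.
by move=> x; apply: differentiable_continuous; apply/derivable1_diffP;
   have [] := is_derive_cos_affine b t x.
Qed.

Let sin_affineC (t b : R) : continuous (fun x : R => sin (t * x + b)).
Proof.
by move=> x; apply: differentiable_continuous; apply/derivable1_diffP;
   have [] := is_derive_sin_affine b t x.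
Qed.

Let integrable_cos t b : mu.-integrable setT (EFin \o (fun x => cos (t * x + b) * pdf x)).
Proof.
apply: (@bmeas_integrable_mull _ _ _ mu pdf).
- exact: integrable_normal_pdf.
- split; first exact: continuous_measurable_fun.
  by exists 1 => x; exact: cos_max.
Qed.

Let integrable_sin_moment t b :
  mu.-integrable setT (EFin \o (fun x => x * sin (t * x + b) * pdf x)).
Proof.
apply: (@le_integrable _ _ _ mu _ measurableT _ _ _ _ integrable_moment).
  apply/measurable_EFinP; apply: measurable_funM; last exact: measurable_normal_pdf.
  by apply: measurable_funM => //; exact: continuous_measurable_fun.
move=> x _; rewrite /= lee_fin !normrM normr_id ler_wpM2r//.
by rewrite -[leRHS]mulr1 ler_wpM2l// sin_max.
Qed.

(** The function [k] is the derivative of sin (t x + b) times the density, as the density has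
    derivative -x / s^2 times itself. That product vanishes at both infinities, so [k] has integral
    0. *)
Let by_parts t b :
  \int[mu]_x (x * sin (t * x + b) * pdf x) = s ^+ 2 * t * \int[mu]_x (cos (t * x + b) * pdf x).
Proof.
have s2 : s ^+ 2 != 0 by rewrite expf_eq0/= gt_eqF.
pose k x := t * (cos (t * x + b) * pdf x) - s ^- 2 * (x * sin (t * x + b) * pdf x).
have ic : mu.-integrable setT (EFin \o (fun x => t * (cos (t * x + b) * pdf x))).
  exact: (integrableZl measurableT t (integrable_cos t b)).
have is_ : mu.-integrable setT (EFin \o (fun x => s ^- 2 * (x * sin (t * x + b) * pdf x))).
  exact: (integrableZl measurableT (s ^- 2) (integrable_sin_moment t b)).
have : \int[mu]_x k x = 0.
  apply: (@improper_FTC _ setT k (fun x => sin (t * x + b) * pdf x)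
    (fun n => - n.+1%:R) (fun n => n.+1%:R)) => //.
  - by move=> n; apply: (@lt_trans _ _ 0); rewrite ?oppr_lt0 ltr0n.
  - move=> x _; near=> n; rewrite -ler_norml ltW//.
    near: n; apply: filterS (nbhs_infty_gtr `|x|) => n /lt_le_trans; apply.
    by rewrite ler_nat.
  - have -> : EFin \o k = (fun x => (t * (cos (t * x + b) * pdf x))%:E -
        (s ^- 2 * (x * sin (t * x + b) * pdf x))%:E)%E by [].
    exact: integrableB.
  - move=> x; apply: cvgB.
      by apply: cvgM; [exact: cvg_cst|apply: cvgM; [exact: cos_affineC|exact: cpdf]].
    apply: cvgM; [exact: cvg_cst|apply: cvgM; last exact: cpdf].
    by apply: cvgM; [exact: cvg_id|exact: sin_affineC].
  - move=> x; apply: (is_derive_eq (is_derive_mul (is_derive_sin_affine b t x) (pdf_derive x))).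
    by rewrite /k; ring.
  - rewrite -[X in _ --> X](subrr 0); apply: cvgB.
      apply: (@squeeze_cvgr _ _ _ _ (fun n => - pdf n.+1%:R) (fun n => pdf n.+1%:R)).
      + apply: nearW => n; rewrite -ler_norml normrM (ger0_norm (normal_pdf_ge0 _ _ _)).
        by rewrite ler_piMl ?normal_pdf_ge0// sin_max.
      + by rewrite -oppr0; apply: cvgN; apply: pdf_cvg0 => n; rewrite normr_nat.
      + by apply: pdf_cvg0 => n; rewrite normr_nat.
    apply: (@squeeze_cvgr _ _ _ _ (fun n => - pdf (- n.+1%:R)) (fun n => pdf (- n.+1%:R))).
    + apply: nearW => n; rewrite -ler_norml normrM (ger0_norm (normal_pdf_ge0 _ _ _)).
      by rewrite ler_piMl ?normal_pdf_ge0// sin_max.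
    + by rewrite -oppr0; apply: cvgN; apply: pdf_cvg0 => n; rewrite normrN normr_nat.
    + by apply: pdf_cvg0 => n; rewrite normrN normr_nat.
rewrite /k RintegralB// !RintegralZl// => /eqP; rewrite subr_eq0 => /eqP h.
by rewrite -mulrA h mulrA mulfV// mul1r.
Unshelve. all: by end_near. Qed.

(** The phase [b] treats both parts of the characteristic function at once: b = 0 gives the cosine,
    b = - pi / 2 the sine. *)
Let chi b t := \int[mu]_x (cos (t * x + b) * pdf x).

(** Differentiation under the integral, dominated by |x| times the density, produces the sine moment
    that [by_parts] turns back into [chi]. The interval ]t - 1, t + 1[ is just some neighbourhood of
    t. *)
Let chi_derive b t : is_derive t (1 : R) (chi b) (- (s ^+ 2 * t) * chi b t).
Proof.
pose f t x := cos (t * x + b) * pdf x.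
have fd u x : is_derive u (1 : R) (f ^~ x) (- (x * sin (u * x + b) * pdf x)).
  have -> : f ^~ x = fun v => cos (x * v + b) * cst (pdf x) v.
    by apply/funext => v; rewrite /f [v * x]mulrC.
  apply: (is_derive_eq (is_derive_mul (is_derive_cos_affine _ _ _) (is_derive_cst _ _ _))).
  by rewrite /cst [u * x]mulrC; ring.
have d1 u x : partial1of2 f u x = - (x * sin (u * x + b) * pdf x).
  by rewrite partial1of2E; apply: derive_val; exact: fd.
have tI : `](t - 1), (t + 1)[%classic t by rewrite /= in_itv/=; lra.
have fi x : `](t - 1), (t + 1)[%classic x -> mu.-integrable setT (EFin \o f x).
  by move=> _; exact: integrable_cos.
have fD u x : `](t - 1), (t + 1)[%classic u -> setT x -> derivable (f ^~ x) u 1.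
  by move=> _ _; have [] := fd u x.
have G0 x : 0 <= `|x| * pdf x by rewrite mulr_ge0// normal_pdf_ge0.
have Gub u x : `](t - 1), (t + 1)[%classic u -> setT x ->
    `|partial1of2 f u x| <= `|x| * pdf x.
  move=> _ _; rewrite d1 normrN !normrM (ger0_norm (normal_pdf_ge0 _ _ _)).
  by rewrite ler_wpM2r ?normal_pdf_ge0// -[leRHS]mulr1 ler_wpM2l// sin_max.
have D := derivable_under_integral measurableT tI fi fD G0 integrable_moment Gub.
have := differentiation_under_integral measurableT tI fi fD G0 integrable_moment Gub.
rewrite derive1E => E; apply: DeriveDef => //.
rewrite E; under eq_Rintegral do rewrite d1 -mulN1r.
by rewrite RintegralZl// by_parts /chi; ring.
Qed.

(** The linear equation for [chi] is solved with the integrating factor exp(s^2 u^2 / 2), which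
    makes [psi] constant; its value at 0 is cos b. *)
Let chiE b t : chi b t = cos b * expR (- (s ^+ 2 / 2) * t ^+ 2).
Proof.
pose psi u := chi b u * expR (s ^+ 2 / 2 * u ^+ 2).
have : psi t = psi 0.
  apply: is_derive_0_is_cst => u.
  apply: (is_derive_eq (is_derive_mul (chi_derive b u) (is_derive_expR_sqr _ _))).
  by field.
rewrite {2}/psi expr0n mulr0 expR0 mulr1 => h.
have -> : cos b = chi b 0.
  rewrite /chi; under eq_Rintegral do rewrite mul0r add0r.
  rewrite RintegralZl//; last exact: integrable_normal_pdf.
  by rewrite /Rintegral integral_normal_pdf mulr1.
by rewrite -h /psi mulNr expRN mulfK// gt_eqF ?expR_gt0.
Qed.

Lemma char_fun_normal_prob (t : R) :
  expectationC (normal_prob 0 s) (fun x => cis (t * x)) = (expR (- (s ^+ 2 * t ^+ 2 / 2)))%:C.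
Proof.
rewrite expectationCE.
under eq_Rintegral do rewrite cisE/= -[t * _]addr0.
under [X in _ +i* X]eq_Rintegral do rewrite cisE/= -cosBpihalf.
rewrite !Rintegral_normal_prob; last 2 first.
- split; first exact: continuous_measurable_fun.
  by exists 1 => x; exact: cos_max.
- split; first exact: continuous_measurable_fun.
  by exists 1 => x; exact: cos_max.
rewrite -[\int[_]_x _]/(chi 0 t) -[X in _ +i* X]/(chi (- (pi / 2)) t) !chiE.
rewrite cos0 cosN cos_pihalf mul0r mul1r.
by apply: eqC => //=; congr expR; lra.
Qed.

End char_fun.
End normal_law.

(** * Exponential law *)

Section exponential_law.
Context {R : realType}.
Notation mu := (@lebesgue_measure R).

Definition exponential_law (l : R) (l0 : 0 < l) : probability _ R :=
  exponential_distribution_exponential_prob__canonical__probability_measure_Probability l0.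

Lemma Rintegral_exponential_law (l : R) (l0 : 0 < l) (f : R -> R) : bmeas f ->
  \int[exponential_law l0]_x f x =
  l * \int[mu]_(x in `[0, +oo[) (expR (- l * x) * f x).
Proof.
move=> bf.
have ip := integrable_exponential_pdf l0.
rewrite (@Rintegral_density _ _ _ mu _ (exponential_pdf l))//; last first.
  by move=> x; apply: exponential_pdf_ge0; exact: ltW.
have ifp : mu.-integrable `[0, +oo[ (EFin \o (fun x => f x * exponential_pdf l x)).
  apply: (@integrableS _ _ _ mu setT) => //; exact: bmeas_integrable_mull.
have E x : `[0, +oo[%classic x -> f x * exponential_pdf l x = l * (expR (- l * x) * f x).
  by rewrite /= in_itv/= andbT => x0; rewrite exponential_pdfE//; ring.
transitivity (\int[mu]_(x in `[0, +oo[) (f x * exponential_pdf l x)).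
  rewrite [RHS]Rintegral_mkcond; apply: eq_Rintegral => x _; rewrite patchE.
  case: ifPn => // xn; rewrite lt0_exponential_pdf ?mulr0// ltNge.
  by move: xn; rewrite notin_setE/= in_itv/= andbT => /negP.
rewrite -RintegralZl//.
  by apply: eq_Rintegral => x /set_mem; exact: E.
have -> : EFin \o (fun x => expR (- l * x) * f x) =
    (fun x => (l^-1)%:E * (l * (expR (- l * x) * f x))%:E)%E.
  by apply/funext => x; rewrite /= -EFinM mulKf// gt_eqF.
apply: integrableZl => //.
by apply: eq_integrable ifp => // x /set_mem xD; rewrite /= E.
Qed.

Lemma integrable_expR_cos (k a b : R) : 0 < k ->
  mu.-integrable `[0, +oo[ (EFin \o (fun x => expR (- k * x) * cos (a * x + b))).
Proof.
move=> k0.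
have ip : mu.-integrable `[0, +oo[ (EFin \o exponential_pdf k).
  by apply: (integrableS _ _ _ (integrable_exponential_pdf k0)).
apply: (@le_integrable _ _ _ mu _ _ _ _ _ _ (integrableZl _ k^-1 ip)) => //.
  apply/measurable_EFinP; apply: measurable_funTS; apply: measurable_funM.
    by apply: measurableT_comp => //; exact: measurable_funM.
  apply: measurableT_comp; first by apply: continuous_measurable_fun; exact: continuous_cos.
  by apply: measurable_funD => //; exact: measurable_funM.
move=> x; rewrite /= in_itv/= andbT => x0.
rewrite lee_fin exponential_pdfE// mulKf ?gt_eqF// normrM -[leRHS]mulr1.
by rewrite ler_wpM2l// cos_max.
Qed.

Lemma Rintegral_expR_cos (k a b : R) : 0 < k ->
  \int[mu]_(x in `[0, +oo[) (expR (- k * x) * cos (a * x + b)) =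
  (k * cos b - a * sin b) / (k ^+ 2 + a ^+ 2).
Proof.
move=> k0; set D := k ^+ 2 + a ^+ 2.
have D0 : D != 0 by rewrite gt_eqF// ltr_pwDl ?exprn_gt0 ?sqr_ge0.
(* The real part of exp((ia - k) x + ib) / (ia - k), the evident complex primitive. *)
pose F x := expR (- k * x) * (a / D * sin (a * x + b) - k / D * cos (a * x + b)).
have dexp x : is_derive x (1 : R) (fun x => expR (- k * x)) (expR (- k * x) * - k).
  apply: (is_derive1_comp (is_derive_expR _)).
  by have := is_derive_affine 0 (- k) x; under eq_fun do rewrite addr0.
apply: (@improper_FTC _ _ _ F (fun=> 0) (fun n => n.+1%:R)) => //.
- by move=> n x; rewrite /= !in_itv/= andbT => /andP[].
- move=> x; rewrite /= in_itv/= andbT => x0; near=> n; rewrite x0/= ltW//.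
  near: n; apply: filterS (nbhs_infty_gtr x) => n /lt_le_trans; apply.
  by rewrite ler_nat.
- exact: integrable_expR_cos.
- move=> x; apply: differentiable_continuous; apply/derivable1_diffP.
  by have [] := is_derive_mul (dexp x) (is_derive_cos_affine b a x).
- move=> x.
  have h1 := is_derive_mul (is_derive_cst (a / D) x 1) (is_derive_sin_affine b a x).
  have h2 := is_derive_mul (is_derive_cst (k / D) x 1) (is_derive_cos_affine b a x).
  apply: (is_derive_eq (is_derive_mul (dexp x) (is_deriveB h1 h2))).
  rewrite -[(_ - _) x]/(a / D * sin (a * x + b) - k / D * cos (a * x + b)) /cst.
  transitivity (expR (- k * x) * cos (a * x + b) * ((k ^+ 2 + a ^+ 2) / D)).
    by ring.
  by rewrite divff// mulr1.
- have -> : (k * cos b - a * sin b) / D = 0 - F 0.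
    by rewrite /F !mulr0 expR0 !add0r; ring.
  apply: cvgB; last exact: cvg_cst.
  pose M := (`|a / D| + `|k / D|) / k.
  have bnd n : `|F n.+1%:R| <= M * n.+1%:R^-1.
    have -> : M * n.+1%:R^-1 = (`|a / D| + `|k / D|) * (k * n.+1%:R)^-1.
      by rewrite invfM mulrA.
    rewrite /F normrM ger0_norm ?expR_ge0// mulrC ler_pM ?expR_ge0//.
      rewrite (le_trans (ler_normB _ _))// lerD// normrM -[leRHS]mulr1 ler_wpM2l//.
        exact: sin_max.
      exact: cos_max.
    rewrite mulNr expRN lef_pV2 ?posrE ?expR_gt0 ?mulr_gt0 ?ltr0n//.
    by have := expR_ge1Dx (k * n.+1%:R); lra.
  have Mcvg : M * n.+1%:R^-1 @[n --> \oo] --> 0.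
    by rewrite -(mulr0 M); apply: cvgM; [exact: cvg_cst|exact: cvg_harmonic].
  apply: (@squeeze_cvgr _ _ _ _ (fun n => - (M * n.+1%:R^-1)) (fun n => M * n.+1%:R^-1)) => //.
    by apply: nearW => n; rewrite -ler_norml.
  by rewrite -oppr0; exact: cvgN.
Unshelve. all: by end_near. Qed.

(** The right-hand side is l / (l - ia). The absolute value changes nothing on the support of the
    law, and provides the everywhere nonnegative variable that [laplace_unique] asks for. *)
Lemma exponential_law_cis (l a : R) (l0 : 0 < l) :
  expectationC (exponential_law l0) (fun x => cis (a * `|x|)) =
  (l ^+ 2 / (l ^+ 2 + a ^+ 2)) +i* (l * a / (l ^+ 2 + a ^+ 2)).
Proof.
have mN : measurable_fun setT (fun x : R => a * `|x|) by exact: measurable_funM.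
have [b1 b2] := bmeasC_cis mN.
rewrite expectationCE !Rintegral_exponential_law//.
have E (x : R) : x \in `[0, +oo[%classic -> `|x| = x.
  by move=> /set_mem; rewrite /= in_itv/= andbT => /ger0_norm.
congr (_ +i* _).
  under eq_Rintegral => x xD do rewrite cisE/= E// -[a * x]addr0.
  by rewrite Rintegral_expR_cos// cos0 sin0; ring.
under eq_Rintegral => x xD do rewrite cisE/= E// -cosBpihalf.
by rewrite Rintegral_expR_cos// cosN cos_pihalf sinN sin_pihalf; ring.
Qed.

Lemma exponential_law_laplace (l t : R) (l0 : 0 < l) : 0 <= t ->
  \int[exponential_law l0]_x expR (- (t * `|x|)) = l / (l + t).
Proof.
move=> t0; rewrite Rintegral_exponential_law//; last first.
  by apply: bmeas_expRN => [|x]; [exact: measurable_funM|rewrite mulr_ge0].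
have E (x : R) : x \in `[0, +oo[%classic ->
    expR (- l * x) * expR (- (t * `|x|)) = expR (- (l + t) * x) * cos (0 * x + 0).
  move=> /set_mem; rewrite /= in_itv/= andbT => /ger0_norm ->.
  by rewrite mul0r addr0 cos0 mulr1 -expRD; congr expR; ring.
under eq_Rintegral => x xD do rewrite E//.
rewrite Rintegral_expR_cos ?ltr_wpDr// cos0 sin0.
by field; rewrite gt_eqF// ltr_wpDr.
Qed.

End exponential_law.

(** * Gaussian mean of exp(-(s - ia) x^2) *)

Section gaussian_chirp.
Context {R : realType}.
Notation N := (@normal_prob R 0 1).

(** Modulus and phase are kept apart: the modulus is at most 1 for s >= 0 and goes into the weight,
    while Laplace uniqueness produces the phase. *)
Definition chirp (s a x : R) : R[i] := (expR (- (s * x ^+ 2)))%:C * cis (a * x ^+ 2).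

Definition chirp_mean (s a : R) := expectationC N (chirp s a).

Lemma measurable_scale_sqr (a : R) : measurable_fun setT (fun x : R => a * x ^+ 2).
Proof. by apply: measurable_funM => //; exact: measurable_sqr. Qed.

Lemma bmeas_gauss (s : R) : 0 <= s -> bmeas (fun x : R => expR (- (s * x ^+ 2))).
Proof.
move=> s0; apply: bmeas_expRN => [|x]; last by rewrite mulr_ge0// sqr_ge0.
exact: measurable_scale_sqr.
Qed.

Lemma bmeasC_chirp (s a : R) : 0 <= s -> bmeasC (chirp s a).
Proof.
move=> s0; apply: bmeasCM; first by apply: bmeasC_real; exact: bmeas_gauss.
by apply: bmeasC_cis; exact: measurable_scale_sqr.
Qed.

(* The sum of the squares of two independent standard Gaussian variables is
   exponential with rate 1/2: compare Laplace transforms. *)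
Lemma chirp_mean_sqr (s a : R) : 0 <= s ->
  ((1 + 2 * s) +i* (- (2 * a))) * chirp_mean s a ^+ 2 = 1.
Proof.
move=> s0; pose l := 1 / 2 + s.
have l0 : 0 < l by rewrite /l; lra.
pose Y (z : R * R) := z.1 ^+ 2 + z.2 ^+ 2.
have Y0 z : 0 <= Y z by rewrite addr_ge0// sqr_ge0.
have mY : measurable_fun setT Y.
  by apply: measurable_funD; apply: measurable_funX.
have bc := bmeasC_chirp a s0.
have EY t z : expR (- (t * Y z)) = expR (- (t * z.1 ^+ 2)) * expR (- (t * z.2 ^+ 2)).
  by rewrite -expRD /Y; congr expR; ring.
have bE t : 0 <= t -> bmeas (fun z => expR (- (t * Y z))).
  move=> t0; apply: bmeas_expRN => [|z]; last by rewrite mulr_ge0.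
  exact: measurable_funM.
have -> : chirp_mean s a ^+ 2 = expectationC (N \x N)%E
    (fun z => (expR (- (s * Y z)))%:C * cis (a * Y z)).
  rewrite -expectationC_prod1; last first.
    apply: bmeasCM; first exact: (bmeasC_real (bE _ s0)).
    by apply: bmeasC_cis; exact: measurable_funM.
  rewrite expr2 -expectationCZ//; congr expectationC; apply/funext => x.
  rewrite mulrC -expectationCZ//; congr expectationC; apply/funext => y.
  rewrite EY real_complexM /chirp/= /Y/= mulrDr cisD; ring.
(* Weighting by exp(-sY) turns the exponential law of rate 1/2 into rate l = 1/2 + s, with total
   mass K = 1 / (2l) = 1 / (1 + 2s). Hence the constant weight [K] on the exponential side. *)
pose K : R[i] := ((2 * l)^-1)%:C.
rewrite (@laplace_unique _ _ _ _ _ _ (exponential_law l0) _ (fun=> K) _ (fun x => `|x|)) //.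
- rewrite expectationCZ; last by apply: bmeasC_cis; exact: measurable_funM.
  rewrite exponential_law_cis /K.
  have D0 : l ^+ 2 + a ^+ 2 != 0 by rewrite gt_eqF// ltr_pwDl ?exprn_gt0 ?sqr_ge0.
  have l1 : l != 0 by rewrite gt_eqF.
  have -> : 1 + 2 * s = 2 * l by rewrite /l; field.
  move: (l) l1 D0 => k k0 D0.
  by apply: eqC; rewrite ?ReM ?ImM/=; field; rewrite D0 k0.
- exact: (bmeasC_real (bE _ s0)).
- exact: bmeasC_cst.
- exact: normr_measurable.
- move=> t t0.
  have st0 : 0 <= s + t by rewrite addr_ge0.
  rewrite expectationCZ; last first.
    apply: bmeasC_real; apply: bmeas_expRN => [|x]; first exact: measurable_funM.
    by rewrite mulr_ge0.
  rewrite [in RHS]expectationC_real exponential_law_laplace//.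
  transitivity (expectationC (N \x N)%E (fun z => (expR (- ((s + t) * Y z)))%:C)).
    congr expectationC; apply/funext => z; rewrite -real_complexM -expRD.
    by congr (expR _)%:C; ring.
  rewrite -expectationC_prod1; last exact: (bmeasC_real (bE _ st0)).
  have -> : (fun x => expectationC N (fun y => (expR (- ((s + t) * Y (x, y))))%:C)) =
      fun x => ((Num.sqrt (1 + 2 * (s + t)))^-1)%:C * (expR (- ((s + t) * x ^+ 2)))%:C.
    apply/funext => x.
    transitivity (expectationC N (fun y => (expR (- ((s + t) * x ^+ 2)))%:C *
        (expR (- ((s + t) * y ^+ 2)))%:C)).
      by congr expectationC; apply/funext => y; rewrite EY real_complexM.
    rewrite expectationCZ; last by apply: bmeasC_real; exact: bmeas_gauss.
    by rewrite expectationC_real normal_laplace_sqr// mulrC.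
  rewrite expectationCZ; last by apply: bmeasC_real; exact: bmeas_gauss.
  rewrite expectationC_real normal_laplace_sqr// -!real_complexM; congr (_ %:C).
  rewrite -expr2 exprVn sqr_sqrtr; last by lra.
  by rewrite /l; field; apply/andP; split; rewrite gt_eqF//; lra.
Qed.

(** If Re phi vanished, phi^2 would be a real number <= 0, whereas the real part of [chirp_mean_sqr]
    would read (1 + 2s) phi^2 = 1. So Re phi has no zero in a; it is continuous and positive at a =
    0, and the intermediate value theorem concludes. *)
Lemma Re_chirp_mean_gt0 (s a : R) : 0 <= s -> 0 < complex.Re (chirp_mean s a).
Proof.
move=> s0; pose q a := complex.Re (chirp_mean s a).
have qE b : q b = \int[N]_x (expR (- (s * x ^+ 2)) * cos (b * x ^+ 2)).
  rewrite /q /chirp_mean expectationCE -[LHS]/(\int[N]_x complex.Re (chirp s b x)).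
  apply: eq_Rintegral => x _.
  by rewrite /chirp cisE ReM/= mul0r subr0.
have q0 : 0 < q 0.
  rewrite qE; under eq_Rintegral do rewrite mul0r cos0 mulr1.
  by rewrite normal_laplace_sqr// invr_gt0 sqrtr_gt0; lra.
have qn b : q b != 0.
  apply/eqP => qb0; have := chirp_mean_sqr b s0.
  have := qb0; rewrite /q; case: (chirp_mean s b) => u v /= -> /=.
  move=> h; have := congr1 (@complex.Re R) h; have := congr1 (@complex.Im R) h.
  rewrite expr2 ReM ImM /= => h1 h2.
  have := sqr_ge0 v; nra.
have qc : continuous q.
  move=> b.
  rewrite (_ : q = fun b =>
      \int[N]_x (expR (- (s * x ^+ 2)) * cos (b * x ^+ 2))); last first.
    by apply/funext => c; exact: qE.
  have bI : b \in `](b - 1), (b + 1)[%classic by rewrite inE/= in_itv/=; lra.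
  apply: (continuity_under_integral measurableT _ _ (bmeas_integrable N (bmeas_cst 1)) _ bI).
  - move=> c _; apply: bmeas_integrable; apply: bmeasM; first exact: bmeas_gauss.
    split; last by exists 1 => x; exact: cos_max.
    apply: measurableT_comp; last exact: measurable_scale_sqr.
    by apply: continuous_measurable_fun; exact: continuous_cos.
  - apply: aeW => x _ c _; apply: cvgM; first exact: cvg_cst.
    apply: (@continuous_cvg _ _ _ _ _ _ (@cos R)); first exact: continuous_cos.
    by apply: cvgM; [exact: cvg_id|exact: cvg_cst].
  - move=> c _; apply: aeW => x _; rewrite normrM -[leRHS]mulr1 ler_pM//.
      by rewrite ger0_norm ?expR_ge0// -expR0 ler_expR oppr_le0 mulr_ge0 ?sqr_ge0.
    exact: cos_max.
rewrite ltNge; apply/negP => qa.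
have IV u v : u <= v -> (q u <= 0 <= q v) || (q v <= 0 <= q u) -> False.
  move=> uv h; have [||c _ qc0] := @IVT R q u v 0 uv.
  - by apply: continuous_subspaceT.
  - by rewrite ge_min le_max; case/orP: h => /andP[-> ->]; rewrite ?orbT.
  - by have := qn c; rewrite qc0 eqxx.
have [a0|a0] := leP 0 a.
  by apply: (IV 0 a a0); rewrite (ltW q0) [q a <= 0]qa orbT.
by apply: (IV a 0 (ltW a0)); rewrite (ltW q0) [q a <= 0]qa.
Qed.

End gaussian_chirp.

(** * Gaussian vectors *)

Section matrix_measurability.
Context {R : realType} {d : measure_display} {T : measurableType d} (m n : nat).

Lemma measurable_coord_mx (i : 'I_m) (j : 'I_n) :
  measurable_fun setT (fun M : 'M[R]_(m, n) => M i j).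
Proof.
move=> _ A mA; rewrite setTI; apply: sub_sigma_algebra.
by exists i, j, A.
Qed.

Lemma measurable_fun_mx (f : T -> 'M[R]_(m, n)) :
  (forall i j, measurable_fun setT (fun t => f t i j)) -> measurable_fun setT f.
Proof.
move=> mf; apply: (@measurability _ _ _ _ setT f (@matrix_cylinders _ R m n)) => //.
move=> _ [_ [i [j [A [mA ->]]]] <-]; rewrite setTI.
by have := mf i j measurableT A mA; rewrite setTI.
Qed.

Lemma measurable_fun_coord_mx (f : T -> 'M[R]_(m, n)) (i : 'I_m) (j : 'I_n) :
  measurable_fun setT f -> measurable_fun setT (fun t => f t i j).
Proof. by move=> mf; exact: (measurableT_comp (measurable_coord_mx i j) mf). Qed.

End matrix_measurability.

Lemma measurable_fun_mulmx (R : realType) (d : measure_display) (T : measurableType d)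
    (m n p : nat) (f : T -> 'M[R]_(m, n)) (g : T -> 'M[R]_(n, p)) :
  measurable_fun setT f -> measurable_fun setT g ->
  measurable_fun setT (fun t => f t *m g t).
Proof.
move=> mf mg; apply: measurable_fun_mx => i j.
under eq_fun do rewrite mxE.
apply: measurable_sum => k.
by apply: measurable_funM; exact: measurable_fun_coord_mx.
Qed.

Section gaussian_vector.
Context {disp : measure_display} {T : measurableType disp} {R : realType}
  (P : probability T R).

Lemma centered_gaussian_char_fun (n : nat) (S : 'M[R]_n) (X : T -> 'cV[R]_n) :
    psd S -> centered_gaussian P S X ->
  forall u : 'cV[R]_n, expectationC P (fun t => cis ((u^T *m X t) 0 0)) =
    (expR (- ((u^T *m S *m u) 0 0 / 2)))%:C.
Proof.
move=> [_ S0] [mX gX] u; set v := (u^T *m S *m u) 0 0.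
pose L t := (u^T *m X t) 0 0.
have mL : measurable_fun setT L.
  by apply: measurable_fun_coord_mx; exact: measurable_fun_mulmx.
(* The factor 1 gives the integrand the form of [char_fun_normal_prob] at t = 1. *)
have bcis : bmeasC (fun x : R => cis (1 * x)) by apply: bmeasC_cis; exact: measurable_funM.
transitivity (expectationC P ((fun x => cis (1 * x)) \o L)).
  by congr expectationC; apply/funext => t /=; rewrite mul1r.
have [v0|v0] := eqVneq v 0.
  rewrite (expectationC_transfer (Q := \d_(0 : R)) mL)//; last first.
    by move=> A mA; rewrite gX// /gaussian_law -/v v0 eqxx.
  rewrite v0 mul0r oppr0 expR0 expectationCE /Rintegral !integral_dirac//.
  + by rewrite !diracT !mul1e mulr0 cisE cos0 sin0.
  + by apply/measurable_EFinP; exact: bcis.2.1.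
  + by apply/measurable_EFinP; exact: bcis.1.1.
have v1 : 0 < v by rewrite lt_neqAle eq_sym v0 S0.
rewrite (expectationC_transfer (Q := normal_prob 0 (Num.sqrt v)) mL)//; last first.
  by move=> A mA; rewrite gX// /gaussian_law -/v (negbTE v0).
rewrite char_fun_normal_prob ?sqrtr_gt0// sqr_sqrtr ?ltW//.
by rewrite expr1n mulr1.
Qed.

(* The Gaussian is its own Fourier transform: exp(-t x^2) is the mean of
   exp(i sqrt(2t) xi x) over xi ~ N(0, 1). *)
Lemma expectationC_weighted_chirp (h : T -> R[i]) (X : T -> R) (c : R[i]) (s a : R) :
    bmeasC h -> measurable_fun setT X -> 0 <= s ->
    (forall v, expectationC P (fun t => h t * cis (v * X t)) =
       c * expectationC (normal_prob 0 1) (fun x => cis (v * x))) ->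
  expectationC P (fun t => h t * chirp s a (X t)) = c * chirp_mean s a.
Proof.
move=> bh mX s0 hX; set N := normal_prob 0 1 in hX *.
have bcisX v : bmeasC (fun t => cis (v * X t)) by apply: bmeasC_cis; exact: measurable_funM.
have cisN v : expectationC N (fun x => cis (v * x)) = (expR (- (v ^+ 2 / 2)))%:C.
  by rewrite char_fun_normal_prob// expr1n mul1r.
have laplaceX t : 0 <= t -> expectationC P (fun w => h w * (expR (- (t * X w ^+ 2)))%:C) =
    c * expectationC N (fun x => (expR (- (t * x ^+ 2)))%:C).
  move=> t0; pose r := Num.sqrt (2 * t).
  have r2 : r ^+ 2 = 2 * t by rewrite sqr_sqrtr// mulr_ge0.
  have E x : (expR (- (t * x ^+ 2)))%:C = expectationC N (fun xi => cis (r * x * xi)).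
    by rewrite cisN exprMn r2; congr (expR _)%:C; field.
  have bF : bmeasC (fun z : T * R => h z.1 * cis (r * X z.1 * z.2)).
    apply: bmeasCM; first exact: (bmeasC_comp _ bh).
    apply: bmeasC_cis; apply: measurable_funM => //; apply: measurable_funM => //.
    exact: measurableT_comp.
  transitivity (expectationC P (fun w => expectationC N (fun xi => h w * cis (r * X w * xi)))).
    congr expectationC; apply/funext => w; rewrite E expectationCZ//.
    by apply: bmeasC_cis; exact: measurable_funM.
  rewrite (expectationC_fubini P N bF)/= -expectationCZ; last first.
    by apply: bmeasC_real; exact: bmeas_gauss.
  congr expectationC; apply/funext => xi.
  (* For fixed xi the roles are exchanged: r xi is now the frequency, so [hX] applies, and [E]
     evaluates the result to c exp(-t xi^2), with xi as the integration variable on the right. *)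
  transitivity (expectationC P (fun w => h w * cis (r * xi * X w))).
    by congr expectationC; apply/funext => w; congr (_ * cis _); ring.
  by rewrite hX E; congr (_ * expectationC _ _); apply/funext => x; congr cis; ring.
have bg t : 0 <= t -> bmeasC (fun w => (expR (- (t * X w ^+ 2)))%:C).
  by move=> t0; apply: bmeasC_real; exact: (bmeas_comp mX (bmeas_gauss t0)).
have bgN t : 0 <= t -> bmeasC (fun x : R => (expR (- (t * x ^+ 2)))%:C).
  by move=> t0; apply: bmeasC_real; exact: bmeas_gauss.
(* The factor exp(-s X^2) joins the weight and the Laplace variable is X^2; the premise at [t] is
   then [laplaceX] at s + t, and the conclusion at frequency [a] is the claim. *)
have := @laplace_unique _ _ _ _ R P N (fun w => h w * (expR (- (s * X w ^+ 2)))%:C)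
  (fun x => c * (expR (- (s * x ^+ 2)))%:C) (fun w => X w ^+ 2) (fun x => x ^+ 2).
move=> /(_ (bmeasCM bh (bg _ s0)) (bmeasCM (bmeasC_cst c) (bgN _ s0))).
move=> /(_ (measurable_funX _ mX) measurable_sqr (fun w => sqr_ge0 _) (fun x => sqr_ge0 _)).
move=> H.
have {}H := H _ a; rewrite /chirp_mean -expectationCZ; last exact: bmeasC_chirp.
transitivity (expectationC P (fun w => h w * (expR (- (s * X w ^+ 2)))%:C * cis (a * X w ^+ 2))).
  by congr expectationC; apply/funext => w; rewrite /chirp mulrA.
rewrite H.
  by congr expectationC; apply/funext => x; rewrite /chirp mulrA.
move=> t t0; have st0 : 0 <= s + t by rewrite addr_ge0.
transitivity (expectationC P (fun w => h w * (expR (- ((s + t) * X w ^+ 2)))%:C)).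
  congr expectationC; apply/funext => w; rewrite -mulrA -real_complexM -expRD.
  by congr (_ * (expR _)%:C); ring.
rewrite laplaceX// -expectationCZ; last exact: bgN.
congr expectationC; apply/funext => w; rewrite -mulrA -real_complexM -expRD.
by congr (_ * (expR _)%:C); ring.
Qed.

(** The base case takes the place of independence of the coordinates: a product of exp(i v_j y_j) is
    exp(i v^T y), whose mean exp(-|v|^2 / 2) splits because the covariance is the identity. The
    factors are then exchanged for chirps one by one. *)
Lemma expectationC_prod_chirp (d : nat) (y : T -> 'cV[R]_d) (s a : R) :
    centered_gaussian P 1%:M y -> 0 <= s ->
  expectationC P (fun t => \prod_j chirp s a (y t j 0)) = chirp_mean s a ^+ d.
Proof.
move=> gy s0; pose N := @normal_prob R 0 1.
pose F0 (f : R -> R[i]) := exists v, f = fun x => cis (v * x).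
pose F1 f := F0 f \/ f = chirp s a.
have bcis v : bmeasC (fun x : R => cis (v * x)) by apply: bmeasC_cis; exact: measurable_funM.
have my j : measurable_fun setT (fun t => y t j 0).
  by apply: measurable_fun_coord_mx; exact: gy.1.
rewrite (@expectationC_prod_extension _ _ T _ R P d (fun j t => y t j 0) my F0 F1
  (fun _ => expectationC N) _ _ _ _ (fun=> chirp s a)).
- by rewrite prodr_const card_ord.
- by move=> f [[v ->]|->]; [exact: bcis|exact: bmeasC_chirp].
- by move=> f; left.
- move=> j h c bh hf f [|->]; first exact: hf.
  by apply: expectationC_weighted_chirp => // v; apply: hf; exists v.
- move=> g /boolp.choice[v gv].
  pose u : 'cV[R]_d := \col_j v j.
  have := centered_gaussian_char_fun _ gy u.
  have -> : (u^T *m 1%:M *m u) 0 0 = \sum_j v j ^+ 2.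
    by rewrite mulmx1 mxE; apply: eq_bigr => j _; rewrite !mxE expr2.
  have -> : (fun t => cis ((u^T *m y t) 0 0)) = (fun t => \prod_j g j (y t j 0)).
    apply/funext => t; under [RHS]eq_bigr do rewrite gv.
    by rewrite -cis_sum mxE; congr cis; apply: eq_bigr => j _; rewrite !mxE.
  move=> ->.
    rewrite mulr_suml -sumrN expR_sum.
    rewrite (big_morph (fun x => x%:C) (id1 := 1) (op1 := *%R))//; last exact: real_complexM.
    by apply: eq_bigr => j _; rewrite gv char_fun_normal_prob// expr1n mul1r.
  split; first by rewrite trmx1.
  move=> w; rewrite mulmx1 mxE; apply: sumr_ge0 => j _.
  by rewrite mxE -expr2 sqr_ge0.
- by move=> j; right.
Qed.

(** For indicators this is independence itself, taken over the whole index set. One factor at a time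
    then passes to a bounded measurable function, by weighted transfer to the law of [X j]. *)
Lemma expectationC_prod_independent (d' : measure_display) (T' : measurableType d')
    (n : nat) (X : 'I_n -> T -> T') (g : 'I_n -> T' -> R[i]) :
    (forall j, measurable_fun setT (X j)) -> mutually_independent P X ->
    (forall j, bmeasC (g j)) ->
  expectationC P (fun t => \prod_j g j (X j t)) =
  \prod_j expectationC P (fun t => g j (X j t)).
Proof.
move=> mX iX bg.
pose F0 (f : T' -> R[i]) := exists2 A, measurable A & f = fun x => (\1_A x)%:C.
have EI j A : measurable A ->
    expectationC P (fun t => (\1_A (X j t))%:C) = (fine (P (X j @^-1` A)))%:C.
  move=> mA; rewrite expectationC_real; congr (_ %:C).
  have mXA : measurable (X j @^-1` A) by rewrite -[X in measurable X]setTI; exact: mX.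
  transitivity (fine (\int[P]_t (\1_(X j @^-1` A) t)%:E)%E) => //.
  by rewrite integral_indic// setIT.
apply: (@expectationC_prod_extension _ _ T T' R P n X mX F0 bmeasC
  (fun j f => expectationC P (fun t => f (X j t)))) => //.
- by move=> f [A mA ->]; apply: bmeasC_real; exact: bmeas_indic.
- move=> j h c bh hf f bf.
  pose Xj : {mfun T >-> T'} := mfun_Sub (mem_set (mX j)).
  have -> : expectationC P (fun t => f (X j t)) = expectationC (distribution P Xj) f.
    exact: (@expectationC_transfer _ _ _ _ _ P (distribution P Xj) (X j)).
  apply: expectationC_weighted_transfer => // A mA.
  by rewrite (hf (fun x => (\1_A x)%:C)) ?EI//; exists A.
- move=> {bg}g' gF.
  have /boolp.choice[A gA] : forall j, exists A, measurable A /\ g' j = fun x => (\1_A x)%:C.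
    by move=> j; have [B mB gB] := gF j; exists B.
  have := iX [set: 'I_n]%SET A (fun j => (gA j).1).
  set B := (X in P X) => PB.
  have mB : measurable B.
    apply: fin_bigcap_measurable => [|j _]; first exact: finite_finset.
    by rewrite -[X in measurable X]setTI; apply: mX => //; exact: (gA j).1.
  transitivity ((fine (P B))%:C).
    transitivity (expectationC P (fun t => (\1_B t)%:C)).
      congr expectationC; apply/funext => t.
      under eq_bigr => j _ do rewrite (gA j).2.
      rewrite -(big_morph (fun x => x%:C) (id1 := 1) (op1 := *%R) (@real_complexM R) erefl).
      congr (_ %:C); rewrite indicE; have [|tB] := boolP (t \in B).
        move=> /set_mem tB; rewrite big1// => j _.
        by rewrite indicE mem_set//; apply: tB; rewrite /= inE.
      have [j jA] : exists j, ~ A j (X j t).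
        apply: contrapT => /forallNP h; move/negP: tB; apply; apply/mem_set => j _.
        exact: contrapT (h j).
      by rewrite (bigD1 j)//= indicE memNset// mul0r.
    rewrite expectationC_real; congr (_ %:C).
    transitivity (fine (\int[P]_t (\1_B t)%:E)%E) => //.
    by rewrite integral_indic// setIT.
  rewrite PB.
  rewrite [RHS](eq_bigr (fun j => (fine (P (X j @^-1` A j)))%:C)); last first.
    by move=> j _; rewrite (gA j).2; apply: EI; exact: (gA j).1.
  have mXA j : measurable (X j @^-1` A j).
    by rewrite -[X in measurable X]setTI; apply: mX => //; exact: (gA j).1.
  transitivity ((\prod_j fine (P (X j @^-1` A j)))%:C); last first.
    exact: (big_morph (fun x => x%:C) (@real_complexM R) erefl).
  congr (_ %:C).
  have -> : (\prod_(j in [set: 'I_n]%SET) P (X j @^-1` A j))%E =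
      (\prod_j (fine (P (X j @^-1` A j)))%:E)%E.
    by apply: eq_big => [j|j _]; rewrite ?inE// fineK//; exact: fin_num_measure.
  by rewrite prodEFin.
Qed.

End gaussian_vector.

Theorem theorem5 (R : realType) (disp : measure_display)
    (T : measurableType disp) (P : probability T R)
    (p d : nat) (hp : (0 < p)%N) (hd : (0 < d)%N)
    (Sigma : 'M[R]_p) (hSigma : psd Sigma) (mu : 'cV[R]_p)
    (W : {RV P >-> 'M[R]_(p, d)}) (y : {RV P >-> 'cV[R]_d})
    (W_indep : mutually_independent P
       (fun (j : 'I_d) (t : T) => col j (W t) : 'cV[R]_p))
    (W_gauss : forall j : 'I_d,
       centered_gaussian P Sigma (fun t => col j (W t)))
    (y_gauss : centered_gaussian P 1%:M y)
    (yW_indep : independent2 P y W) :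
  GAL P (2 *: Sigma) (2 *: mu) (d%:R / 2)
    (fun t => W t *m y t + norm2 (y t) ^+ 2 *: mu).
Proof.
have [SigmaT Sigma0] := hSigma.
have ZE m n (k : R) (A : 'M[R]_(m, n)) i j : (k *: A) i j = k * A i j by rewrite mxE.
have TZ m n (k : R) (A : 'M[R]_(m, n)) : (k *: A)^T = k *: A^T by rewrite linearZ.
have norm2E (v : 'cV[R]_d) : norm2 v ^+ 2 = \sum_j v j 0 ^+ 2.
  by rewrite sqr_sqrtr// sumr_ge0// => j _; exact: sqr_ge0.
pose Z (z : 'cV[R]_d * 'M[R]_(p, d)) := z.2 *m z.1 + norm2 z.1 ^+ 2 *: mu.
have mZ : measurable_fun setT Z.
  apply: measurable_fun_mx => i j; under eq_fun do rewrite !mxE norm2E.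
  apply: measurable_funD.
    apply: measurable_sum => k; apply: measurable_funM.
      by apply: measurable_fun_coord_mx; exact: measurable_snd.
    by apply: measurable_fun_coord_mx; exact: measurable_fst.
  apply: measurable_funM => //; apply: measurable_sum => k; apply: measurable_funX.
  by apply: measurable_fun_coord_mx; exact: measurable_fst.
split.
- by rewrite divr_gt0 ?ltr0n.
- split; first by rewrite TZ SigmaT.
  by move=> u; rewrite -scalemxAr -scalemxAl mxE mulr_ge0.
- have mYW : measurable_fun setT (fun t => (y t, W t)).
    by apply/measurable_fun_pairP; split; exact: measurable_funP.
  exact: (measurableT_comp mZ mYW).
move=> u; pose s := (u^T *m Sigma *m u) 0 0 / 2; pose a := (u^T *m mu) 0 0.
have s0 : 0 <= s by rewrite divr_ge0.
pose F z := cis ((u^T *m Z z) 0 0).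
have bF : bmeasC F.
  apply: bmeasC_cis; apply: measurable_fun_coord_mx.
  by apply: measurable_fun_mulmx.
rewrite /char_fun -[LHS]/(expectationC P (fun t => F (y t, W t))).
rewrite (expectationC_independent yW_indep bF).
have -> : (fun r => expectationC P (fun t => F (y r, W t))) =
    (fun r => \prod_j chirp s a (y r j 0)).
  apply/funext => r; set v := y r.
  have FE t : F (v, W t) =
      cis (a * \sum_j v j 0 ^+ 2) * \prod_j cis (v j 0 * (u^T *m col j (W t)) 0 0).
    rewrite /F /Z/= mulmxDr mxE addrC cisD norm2E -scalemxAr mxE mulrC.
    rewrite mulrC [_ * (u^T *m mu) 0 0]mulrC; congr (_ * _).
    rewrite mulmxA mxE cis_sum; apply: eq_bigr => j _; congr cis.
    rewrite mulrC !mxE; congr (_ * _).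
    by apply: eq_bigr => i _; rewrite !mxE.
  have bcis (j : 'I_d) : bmeasC (fun w : 'cV[R]_p => cis (v j 0 * (u^T *m w) 0 0)).
    apply: bmeasC_cis; apply: measurable_funM => //; apply: measurable_fun_coord_mx.
    by apply: measurable_fun_mulmx.
  have mW j : measurable_fun setT (fun t => col j (W t)) by have [] := W_gauss j.
  under eq_fun do rewrite FE.
  rewrite expectationCZ; last first.
    by apply: bmeasC_prod => j; exact: (bmeasC_comp (mW j) (bcis j)).
  rewrite (expectationC_prod_independent mW W_indep bcis).
  have -> : cis (a * \sum_j v j 0 ^+ 2) = \prod_j cis (a * v j 0 ^+ 2).
    by rewrite mulr_sumr cis_sum.
  rewrite -big_split/=; apply: eq_bigr => j _; rewrite /chirp mulrC; congr (_ * _).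
  (* The scalar v_j is moved into the test vector, and the characteristic function of the column at
     v_j u gives exp(-v_j^2 u^T Sigma u / 2). *)
  transitivity (expectationC P (fun t => cis (((v j 0 *: u)^T *m col j (W t)) 0 0))).
    by congr expectationC; apply/funext => t; rewrite TZ -scalemxAl ZE.
  rewrite (centered_gaussian_char_fun hSigma (W_gauss j)); congr (expR _)%:C.
  by rewrite TZ -!scalemxAl -scalemxAr !ZE /s; field.
rewrite (expectationC_prod_chirp a y_gauss s0).
have muE : (mu^T *m u) 0 0 = a.
  by rewrite /a !mxE; apply: eq_bigr => i _; rewrite !mxE mulrC.
rewrite -scalemxAr -scalemxAl TZ -scalemxAl.
set w := chirp_mean s a; have w2 := chirp_mean_sqr a s0.
set z := 1 / _.
have zw : w ^+ 2 = z.
  (* The factors 2 in the parameters enter here: half of u^T (2 Sigma) u is 2s, and (2 mu)^T u is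
     2a. *)
  rewrite /z (_ : _ - _ = (1 + 2 * s) +i* (- (2 * a))); last first.
    rewrite !ZE muE; apply: eqC.
      by rewrite ReD ReN ReM ReD /= /s; field.
    by rewrite ImD ImN ImM ImD /=; ring.
  set D := (_ +i* _) in w2 *; have D0 : D != 0.
    by apply/eqP => D0; move/eqP: w2; rewrite D0 mul0r eq_sym oner_eq0.
  by rewrite -(mulKf D0 (w ^+ 2)) w2 mulr1 div1r.
apply/esym; apply: powC_half_sqrt => //; last exact: Re_chirp_mean_gt0.
have q0 : 0 < 1 + 2 * s by lra.
have D0 : 0 < (1 + 2 * s) ^+ 2 + (2 * a) ^+ 2 by rewrite ltr_pwDl ?exprn_gt0 ?sqr_ge0.
rewrite -(pmulr_lgt0 _ D0) -zw.
move: (w ^+ 2) w2 => [x1 x2] w2.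
have := congr1 (@complex.Im R) w2; have := congr1 (@complex.Re R) w2.
rewrite ReM ImM/= => h1 h2.
(* This is Re (1 / D) = Re D / |D|^2 for D = 1 + 2s - 2ia, read off the two parts of D w^2 = 1 so
   that no complex quotient has to be expanded. *)
suff -> : x1 * ((1 + 2 * s) ^+ 2 + (2 * a) ^+ 2) = 1 + 2 * s by [].
have h3 : (1 + 2 * s) * x2 = 2 * a * x1 by lra.
transitivity ((1 + 2 * s) * ((1 + 2 * s) * x1 - - (2 * a) * x2)); last by rewrite h1 mulr1.
transitivity ((1 + 2 * s) ^+ 2 * x1 + 2 * a * (2 * a * x1)); first by ring.
by rewrite -h3; ring.
Qed.
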